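(* Fix the integer $N$ (the dimension). Consider the simple random walk on the rectangular torus $$\Gamma=\mathbb Z_{a_1}\times\mathbb Z_{a_2}\times\dots\times\mathbb Z_{a_N},$$ where $1\le a_1\le a_2\le\dots\le a_N$ are integers, and let $D$ be its diameter. Then for vertices $x,y$ of $\Gamma$ such that $d(x,y)\asymp D$, $$H(x,y)\asymp_N \max\Big\{\prod_{i=1}^Na_i,\ a_Na_{N-1}\log\Big(\frac{a_{N-1}}{a_{N-2}}\Big),\ a_N^2\Big\}.$$ If $N<3$, one uses the formula with $N=3$ and sets the appropriate $a_i$'s to $1$. With $N=3$ and $a_1=1$, writing $a=a_3\ge b=a_2$, the expression reduces to the two-dimensional estimate $H(x,y)\asymp\max(ab\log b,\ a^2)$.
   Context: $\mathbb Z_a=\mathbb Z/a\mathbb Z$. The rectangular torus $\Gamma$ is the graph with vertex set $\prod_i\mathbb Z_{a_i}$ in which two distinct vertices are adjacent if they differ in exactly one coordinate $i$, and there by $\pm1$ modulo $a_i$. The simple random walk moves at each step to a uniformly chosen neighbor. $d$ is the graph distance and $D$ the maximal distance between two vertices. For the walk $(X_n)_{n\ge0}$ with $X_0=x$, $\tau_y=\min\{n\ge0:X_n=y\}$ and $H(x,y)=\mathbb E_x[\tau_y]$ is the expected hitting time. For non-negative $f,g$, $f\asymp g$ means that there is a constant $c>0$ such that $c^{-1}g\le f\le c\,g$ uniformly over the arguments. Thus $d(x,y)\asymp D$ means that the distance is at least $c_0D$ for a fixed $c_0>0$ (it is always at most $D$), and $\asymp_N$ means that the comparison constant may depend on $N$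 (and on the constant in $d(x,y)\asymp D$), but not on the $a_i$ or on $x,y$. *)

(* Defs.v *)
From HB Require Import structures.
From mathcomp Require Import all_boot all_order all_algebra.
From mathcomp Require Import all_classical all_reals all_analysis.
Set Implicit Arguments.
Unset Strict Implicit.
Unset Printing Implicit Defensive.
Import Order.TTheory GRing.Theory Num.Theory.
Local Open Scope classical_set_scope.
Local Open Scope ring_scope.

Section Graph.
Variables (V : finType) (e : rel V).

Definition walk_of_length (n : nat) (x y : V) : bool :=
  [exists p : n.-tuple V, path e x p && (last x p == y)].

(* A shortest walk in a finite graph has fewer than #|V| edges, so bounding the
   minimum loses nothing; #|V| is returned when y is not reachable from x. *)
Definition gdist (x y : V) : nat :=
  \big[minn/#|V|]_(n < #|V| | walk_of_length n x y) n.

Definition gdiam : nat := \max_(x : V) \max_(y : V) gdist x y.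

Definition gdeg (x : V) : nat := #|[pred z | e x z]|.

Definition step_prob (R : realType) (x z : V) : R :=
  if e x z then (gdeg x)%:R^-1 else 0.

(* The law of X_(n+1) given any past X_0 = w 0, ..., X_n = w n is uniform on the
   neighbours of w n.  If some vertex x has no neighbour, no process satisfies
   this from x, since the step probabilities out of x then sum to 0. *)
Definition simple_random_walk (R : realType) (d : measure_display)
    (Omega : measurableType d) (P : probability Omega R)
    (x : V) (X : nat -> Omega -> V) : Prop :=
  [/\ forall n v, measurable [set om | X n om = v],
      P [set om | X 0%N om = x] = 1%E
    & forall (n : nat) (w : nat -> V) (z : V),
        let past := [set om | forall i, (i <= n)%N -> X i om = w i] in
        P (past `&` [set om | X n.+1 om = z]) =
          ((step_prob R (w n) z)%:E * P past)%E].

End Graph.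

(* An infimum over a set of naturals: the minimum if y is hit, +oo if not. *)
Definition hitting_time (R : realType) (V Omega : Type)
    (X : nat -> Omega -> V) (y : V) (om : Omega) : \bar R :=
  ereal_inf [set (n%:R)%:E | n in [set n | X n om = y]].

Definition expected_hitting_time (R : realType) (V : Type)
    (d : measure_display) (Omega : measurableType d) (P : probability Omega R)
    (X : nat -> Omega -> V) (y : V) : \bar R :=
  (\int[P]_om hitting_time R X y om)%E.

(* Z/a is carried by 'I_a rather than 'Z_a, because 'Z_1 has two elements. *)
Definition torus (N : nat) (a : 'I_N -> nat) : finType :=
  {dffun forall i : 'I_N, 'I_(a i)}.

Definition torus_adj (N : nat) (a : 'I_N -> nat) : rel (torus a) :=
  fun x y => [exists i : 'I_N,
    [forall j : 'I_N, (x j != y j) == (j == i)] &&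
    (((x i).+1 == y i %[mod a i]) || ((y i).+1 == x i %[mod a i]))].

Definition torus_sides (N : nat) (a : 'I_N -> nat) : Prop :=
  (forall i, (1 <= a i)%N) /\ (forall i j : 'I_N, (i <= j)%N -> (a i <= a j)%N).

(* top_side a k is a_(N-k) in 1-based indexing; the default 1 of nth supplies
   the missing sides when N < 3. *)
Definition top_side (N : nat) (a : 'I_N -> nat) (k : nat) : nat :=
  nth 1%N (rev (codom a)) k.

Definition hitting_scale (R : realType) (N : nat) (a : 'I_N -> nat) : R :=
  Num.max (\prod_(i < N) a i)%N%:R
    (Num.max
      ((top_side a 0)%:R * (top_side a 1)%:R
         * ln ((top_side a 1)%:R / (top_side a 2)%:R))
      ((top_side a 0)%:R ^+ 2)).

(* H(x,y) is comparable to F a, uniformly over the side vectors a in the class S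
   and over the vertices x, y with d(x,y) >= c0 * D; the constant C depends only
   on N, S, F and c0.  H(x,y) is computed from an arbitrary realisation of the
   walk started at x, whose law is determined by simple_random_walk. *)
Definition hitting_comparable (R : realType) (N : nat)
    (S : ('I_N -> nat) -> Prop) (F : ('I_N -> nat) -> R) : Prop :=
  forall c0 : R, 0 < c0 ->
  exists2 C : R, 0 < C &
    forall a : 'I_N -> nat, S a ->
    forall x y : torus a,
      c0 * (gdiam (@torus_adj N a))%:R <= (gdist (@torus_adj N a) x y)%:R ->
    forall (d : measure_display) (Omega : measurableType d)
      (P : probability Omega R) (X : nat -> Omega -> torus a),
      simple_random_walk (@torus_adj N a) P x X ->
      ((C^-1 * F a)%:E <= expected_hitting_time P X y)%E /\
      (expected_hitting_time P X y <= (C * F a)%:E)%E.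

(* Main.v *)
Require Import Defs.
From mathcomp Require Import all_boot all_order all_algebra.
From mathcomp Require Import all_classical all_reals all_analysis.
From mathcomp Require Import zify ring lra.
Import Order.TTheory GRing.Theory Num.Theory.
Import numFieldNormedType.Exports.
Local Open Scope ring_scope.
Set Implicit Arguments.
Unset Strict Implicit.
Unset Printing Implicit Defensive.

(** The expected hitting time of [y] is the unique bounded solution of the Poisson
    equation h = 1 + P h away from [y] with h y = 0.  On a torus the characters
    diagonalise the walk, so this solution is explicit ([green],
    [hitting_time_green]):
      H(x,y) = deg * sum over k <> 0 of (1 - cos(phase k x y)) / eigenvalue k,
    where the eigenvalue of the frequency k is, up to constants depending on N,
    the maximum over i of (|k_i| / a_i)^2, with |k_i| the distance of k_i to 0 on
    the cycle.

    Upper bound.  Drop the phases.  Writing each inverse eigenvalue as a sum of m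
    over the scales m at which k still lies in the box |k_i| <= a_i / m and
    exchanging the sums leaves ([green_le])
      sum over m <= a_N of m * prod_i (4 * floor(a_i / m) + 1).
    Let A >= B >= C be the three longest sides.  Scales m <= C contribute at most
    prod_i a_i / m^2, scales C < m <= B contribute A * B / m, and scales
    B < m <= A contribute A: these sum to the volume, to A * B * ln (B / C) and to
    A^2 respectively ([clipped_sum]).

    Lower bound.  By summation by parts and positivity of the Dirichlet form,
    every function f satisfies
      deg * volume * (f x - f y)^2 <= 2 * H(x,y) * energy f
    ([dirichlet_principle]).  The indicator of x gives the volume, the distance
    to y along a coordinate in which x and y are far apart gives A^2, and a
    truncated harmonic sum of the sup distance to y in the two longest
    coordinates, the potential of the plane, gives A * B * H_r where H_r is the
    r-th harmonic number and r is that sup distance.  Since d(x,y) is at least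
    c D, some coordinate has distance at least a constant times A
    ([far_coordinate]).  If it is one of the two longest, H_r is at least
    ln A minus a constant; otherwise C is already comparable with A and the
    logarithm is bounded, so that A^2 dominates ([green_lower]).

    The torus with a single vertex carries no walk, since its vertex has no
    neighbour ([walk_has_neighbour]); this is why x <> y follows from the distance
    hypothesis. *)

(** * Hitting times and the Poisson equation *)

Section HittingTime.
Local Open Scope classical_set_scope.
Context (R : realType) (d : measure_display) (Omega : measurableType d)
        (P : probability Omega R).

Local Notation prb B := (fine (P B)).

Let prbE B : measurable B -> P B = (prb B)%:E.
Proof. by move=> mB; rewrite fineK// fin_num_measure. Qed.

Let prb_ge0 B : 0 <= prb B.
Proof. exact: fine_ge0. Qed.

Lemma fibre_sum (T : finType) (Y : Omega -> T)
    (mY : forall t, measurable [set om | Y om = t]) (B : set Omega) :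
  measurable B -> prb B = \sum_t prb (B `&` [set om | Y om = t]).
Proof.
move=> mB; have mBY t : measurable (B `&` [set om | Y om = t]) by exact: measurableI.
apply: EFin_inj; rewrite -sumEFin -prbE //.
under eq_bigr do rewrite -prbE //.
have {1}-> : B = \bigcup_(t in [set: T]) (B `&` [set om | Y om = t]).
  by apply/seteqP; split => [om Bom|om [t _ []//]]; exists (Y om).
rewrite measure_fin_bigcup //; last 2 first.
- exact: finite_finset.
- by move=> s t _ _ [om [[_ <-] [_ <-]]].
rewrite (fsbig_seq _ _ (index_enum_uniq T)).
rewrite (_ : [set` index_enum T] = [set: T]) //.
by apply/seteqP; split=> t //= _; rewrite mem_index_enum.
Qed.

Context (V : finType) (e : rel V) (x : V) (X : nat -> Omega -> V).
Hypothesis walkX : simple_random_walk e P x X.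

Let mX n v : measurable [set om | X n om = v].
Proof. by case: walkX. Qed.

Let hist n om : {ffun 'I_n.+1 -> V} := [ffun i : 'I_n.+1 => X i om].

Let histE n om t : (hist n om = t) <-> (forall i, (i <= n)%N -> X i om = t (inord i)).
Proof.
split=> [<- i lein|H]; first by rewrite ffunE inordK.
apply/ffunP => i; rewrite ffunE H ?inord_val //; exact: (ltn_ord i).
Qed.

Let mhist n t : measurable [set om | hist n om = t].
Proof.
have -> : [set om | hist n om = t] =
    \bigcap_(i in [set i | (i <= n)%N]) [set om | X i om = t (inord i)].
  by apply/seteqP; split=> om /histE.
by apply: bigcap_measurableType => i _; exact: mX.
Qed.

(** The defining property fixes a whole past trajectory; summing over the
    trajectories in [S] gives the Markov property for an event of the past that
    determines the current position. *)
Lemma markov_step n (S : {pred {ffun 'I_n.+1 -> V}}) u z :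
  (forall t, t \in S -> t ord_max = u) ->
  prb ([set om | hist n om \in S] `&` [set om | X n.+1 om = z]) =
    step_prob e R u z * prb [set om | hist n om \in S].
Proof.
move=> Su; set B := [set om | _ \in S].
have mB : measurable B.
  have -> : B = \bigcup_(t in [set` S]) [set om | hist n om = t].
    by apply/seteqP; split=> [om Bom|om [t St /= ht]];
      [exists (hist n om)|rewrite /B /= ht].
  exact: fin_bigcup_measurable.
have mBZ : measurable (B `&` [set om | X n.+1 om = z]) by exact: measurableI.
rewrite (fibre_sum (mhist (n := n)) mBZ) (fibre_sum (mhist (n := n)) mB).
rewrite mulr_sumr; apply: eq_bigr => t _.
have [St|St] := boolP (t \in S); last first.
  have K C : C `<=` B -> prb (C `&` [set om | hist n om = t]) = 0.
    move=> CB; rewrite (_ : _ `&` _ = set0) ?measure0//.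
    by apply/seteqP; split=> // om [/CB /= + ht]; rewrite /B /= ht (negPf St).
  by rewrite !K ?mulr0//; exact: subIsetl.
have Bt : B `&` [set om | hist n om = t] = [set om | hist n om = t].
  by apply/seteqP; split=> [om []//|om /= ht]; split=> //; rewrite /B /= ht.
rewrite setIAC Bt; have [_ _ /(_ n (fun i => t (inord i)) z) /=] := walkX.
have -> : [set om | forall i, (i <= n)%N -> X i om = t (inord i)] =
          [set om | hist n om = t] by apply/seteqP; split=> om /histE.
move=> ->; rewrite -(Su t St) (_ : inord n = ord_max); last first.
  by apply: val_inj; rewrite /= inordK.
by rewrite fineM // fin_num_measure.
Qed.
Variable y : V.

Let alive n := [set om | forall i, (i <= n)%N -> X i om <> y].

(* The sub-probability of being at [u] at time [n] without having met [y]. *)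
Let occ n u : R := prb (alive n `&` [set om | X n om = u]).

Let aliveE n u : alive n `&` [set om | X n om = u] =
  [set om | hist n om \in
     [pred t : {ffun 'I_n.+1 -> V} | [forall i, t i != y] && (t ord_max == u)]].
Proof.
apply/seteqP; split=> om /=; rewrite inE.
  move=> [al <-]; rewrite ffunE eqxx andbT; apply/forallP => i.
  by rewrite ffunE; apply/eqP/al; rewrite -ltnS.
move=> /andP[/forallP al /eqP <-]; rewrite ffunE; split=> // i lein.
by have /eqP := al (inord i); rewrite ffunE inordK.
Qed.

Let malive n : measurable (alive n).
Proof.
have -> : alive n = \bigcap_(i in [set i | (i <= n)%N]) ~` [set om | X i om = y].
  by apply/seteqP; split=> om.
by apply: bigcap_measurableType => i _; apply: measurableC; exact: mX.
Qed.

Let occ_step n z : z != y -> occ n.+1 z = \sum_u step_prob e R u z * occ n u.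
Proof.
move=> zy; rewrite /occ.
have -> : alive n.+1 `&` [set om | X n.+1 om = z] = alive n `&` [set om | X n.+1 om = z].
  apply/seteqP; split=> om [al Xz]; split=> // i lei; first exact/al/leqW.
  move: lei; rewrite leq_eqVlt => /orP[/eqP ->|]; last by rewrite ltnS => /al.
  by rewrite Xz; apply/eqP.
rewrite (fibre_sum (mX n)); last exact: measurableI.
apply: eq_bigr => u _; rewrite setIAC aliveE; apply: markov_step => t.
by rewrite inE => /andP[_ /eqP].
Qed.

Let occ_at_target n : occ n y = 0.
Proof.
rewrite /occ (_ : _ `&` _ = set0) ?measure0//.
by apply/seteqP; split=> // om [/(_ n (leqnn n))].
Qed.

Let alive_sum n : prb (alive n) = \sum_u occ n u.
Proof. exact: fibre_sum. Qed.

Variable h : V -> R.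
Hypotheses (xy : x != y) (hy : h y = 0) (h_ge0 : forall v, 0 <= h v)
  (poisson : forall v, v != y -> h v = 1 + \sum_z step_prob e R v z * h z).

Let occ_start : \sum_u occ 0 u * h u = h x.
Proof.
have P0 : P [set om | X 0%N om = x] = 1%E by case: walkX.
rewrite (bigD1 x) //= big1 => [|u ux].
  rewrite /occ (_ : _ `&` _ = [set om | X 0%N om = x]) ?P0 /= ?mul1r ?addr0 //.
  apply/seteqP; split=> [om []//|om /= X0]; split=> // i.
  by rewrite leqn0 => /eqP ->; rewrite X0; apply/eqP.
suff -> : occ 0 u = 0 by rewrite mul0r.
have Px : P (~` [set om | X 0%N om = x]) = 0%E.
  by rewrite probability_setC // P0 -EFinB subrr.
rewrite /occ (_ : P _ = 0%E) //; apply: subset_measure0 Px => //.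
- exact: measurableI.
- exact: measurableC.
- by move=> om [_ /= ->]; apply/eqP.
Qed.

(* One step of the killed walk lowers the mean of [h] by exactly the survival
   probability; this telescopes to the tail sum of the hitting time. *)
Let mean_step n : \sum_u occ n.+1 u * h u = \sum_u occ n u * h u - prb (alive n).
Proof.
have -> : \sum_u occ n.+1 u * h u =
    \sum_u \sum_w occ n w * (step_prob e R w u * h u).
  apply: eq_bigr => u _; have [->|uy] := eqVneq u y.
    by rewrite hy mulr0 big1 // => w _; rewrite !mulr0.
  rewrite occ_step // mulr_suml; apply: eq_bigr => w _.
  by rewrite mulrAC mulrC.
rewrite exchange_big /= alive_sum -sumrB; apply: eq_bigr => w _.
rewrite -mulr_sumr; have [->|wy] := eqVneq w y.
  by rewrite occ_at_target !mul0r subrr.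
by rewrite [in RHS]poisson // mulrDr mulr1 addrAC subrr add0r.
Qed.

Let mean_sum n : \sum_(0 <= k < n) prb (alive k) = h x - \sum_u occ n u * h u.
Proof.
elim: n => [|n IHn]; first by rewrite big_nil occ_start subrr.
by rewrite big_nat_recr //= IHn mean_step; ring.
Qed.

(* The telescoped identity bounds the tail sum by [h x], so the survival
   probabilities tend to 0, and [h] is bounded because [V] is finite. *)
Let mean_cvg : (fun n => \sum_u occ n u * h u) @ \oo --> (0 : R).
Proof.
have alive_cvg : (fun n => prb (alive n)) @ \oo --> (0 : R).
  apply: cvg_series_cvg_0; apply: nondecreasing_is_cvgn.
    apply/nondecreasing_seqP => n; rewrite /series /= big_nat_recr //=.
    by rewrite lerDl.
  exists (h x) => _ [n _ <-]; rewrite /series /= mean_sum gerBl.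
  apply: sumr_ge0 => u _; exact: mulr_ge0 (prb_ge0 _) (h_ge0 _).
apply: (@squeeze_cvgr _ _ _ _ (fun=> 0) (fun n => prb (alive n) * \sum_u h u)).
- near=> n; apply/andP; split.
    by apply: sumr_ge0 => u _; exact: mulr_ge0 (prb_ge0 _) (h_ge0 _).
  rewrite alive_sum mulr_suml; apply: ler_sum => u _; apply: ler_wpM2l; first exact: prb_ge0.
  by rewrite (bigD1 u) //= lerDl sumr_ge0.
- exact: cvg_cst.
- have := cvgMr_tmp (b := \sum_u h u) alive_cvg; rewrite mul0r; apply.
Unshelve. all: by end_near. Qed.

Let hitting_time_tail om :
  hitting_time R X y om = (\sum_(0 <= k <oo) (\1_(alive k) om)%:E)%E.
Proof.
have ind_ge0 k : (0 <= (\1_(alive k) om : R)%:E)%E by rewrite lee_fin.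
rewrite /hitting_time; have [[n0 Xn0]|never] := pselect (exists n, X n om = y).
  have : exists n, X n om == y by exists n0; apply/eqP.
  case/ex_minnP => n /eqP Xn nmin.
  have aliveP k : alive k om <-> (k < n)%N.
    split=> [al|kn i ik Xi]; first by rewrite ltnNge; apply/negP => /al.
    by have /nmin := introT eqP Xi; rewrite leqNgt (leq_ltn_trans ik kn).
  rewrite (nneseries_split 0 n) // add0n.
  rewrite [X in (_ + X)%E]eseries0 ?adde0 => [|k nk _]; last first.
    by rewrite indicE memNset // => /aliveP; rewrite ltnNge nk.
  rewrite (eq_big_nat _ _ (F2 := fun=> (1 : R)%:E)) => [|k /andP[_ kn]]; last first.
    by rewrite indicE mem_set //; apply/aliveP.
  rewrite sumEFin sumr_const_nat subn0.
  apply/eqP; rewrite eq_le; apply/andP; split.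
    by apply: ereal_inf_lbound; exists n.
  apply: le_ereal_inf_tmp => _ [m /= Xm <-]; rewrite lee_fin ler_nat.
  by apply: nmin; apply/eqP.
have -> : [set n | X n om = y] = set0.
  by apply/seteqP; split=> // n Xn; apply: never; exists n.
rewrite image_set0 ereal_inf0; apply/esym/eqyP => r r0.
pose n := Num.bound r; apply: (@le_trans _ _ (n%:R)%:E).
  by rewrite lee_fin ltW // archi_boundP // ltW.
apply: le_trans (nneseries_lim_ge n _) => //.
rewrite (eq_bigr (fun=> (1 : R)%:E)) => [|k _]; last first.
  by rewrite indicE mem_set // => i _ Xi; apply: never; exists i.
by rewrite sumEFin sumr_const_nat subn0.
Qed.

(** The expectation is the sum of the survival probabilities, which telescopes
    to [h x].  Positivity of [h] is what excludes an infinite expectation. *)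
Theorem expected_hitting_time_poisson : expected_hitting_time P X y = (h x)%:E.
Proof.
rewrite /expected_hitting_time; under eq_integral do rewrite hitting_time_tail.
rewrite integral_nneseries //; last first.
  move=> n; apply/measurable_realfun.measurable_EFinP.
  exact: measurable_realfun.measurable_indic.
rewrite (eq_eseriesr (g := fun n => (prb (alive n))%:E)) => [|n _]; last first.
  by rewrite integral_indic // setIT; exact: prbE.
apply: cvg_lim => //.
rewrite (_ : (fun n => _) = (fun n => (h x - \sum_u occ n u * h u)%:E)).
  apply: cvg_EFin; first by near=> n.
  rewrite /comp /= -[X in _ --> X]subr0; apply: cvgB mean_cvg; exact: cvg_cst.
by apply/funext => n; rewrite sumEFin mean_sum.
Unshelve. all: by end_near. Qed.

End HittingTime.

(** * The Laplacian of a torus *)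

Section TorusGraph.
Variables (N : nat) (a : 'I_N -> nat).
Implicit Types (i j : 'I_N) (u v : torus a).

Definition shift i u : torus a :=
  finfun (fun j => if j == i then ordS (u j) else u j).

Definition unshift i u : torus a :=
  finfun (fun j => if j == i then ord_pred (u j) else u j).

Lemma shift_at i u j : shift i u j = if j == i then ordS (u j) else u j.
Proof. by rewrite ffunE. Qed.

Lemma unshift_at i u j : unshift i u j = if j == i then ord_pred (u j) else u j.
Proof. by rewrite ffunE. Qed.

Lemma shiftK i : cancel (shift i) (unshift i).
Proof.
by move=> u; apply/ffunP => j; rewrite !ffunE; case: eqP => // _; rewrite ordSK.
Qed.

Lemma unshiftK i : cancel (unshift i) (shift i).
Proof.
by move=> u; apply/ffunP => j; rewrite !ffunE; case: eqP => // _; rewrite ord_predK.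
Qed.

(** A cycle of length 1 has no edge and a cycle of length 2 a single one. *)
Definition cycle_deg n := minn 2 n.-1.

Definition torus_deg : nat := \sum_i cycle_deg (a i).

Lemma ordS_val n (k : 'I_n) : ordS k = (if k.+1 == n then 0 else k.+1)%N :> nat.
Proof.
rewrite /=; case: eqP => [->|/eqP kn]; first by rewrite modnn.
by rewrite modn_small // ltn_neqAle kn ltn_ord.
Qed.

Lemma ord_pred_val n (k : 'I_n) :
  ord_pred k = (if k == 0 :> nat then n.-1 else k.-1)%N :> nat.
Proof.
have kn := ltn_ord k; rewrite /=; case: eqP => [->|/eqP k0].
  by rewrite add0n modn_small // prednK // (leq_ltn_trans _ kn).
by rewrite -[in LHS](prednK (n := k)) ?lt0n // addSn /= modnDr modn_small //; lia.
Qed.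

Definition adj_along i u v := (v != u) && ((v == shift i u) || (v == unshift i u)).

Lemma adj_along_inj i j u v : adj_along i u v -> adj_along j u v -> i = j.
Proof.
move=> /andP[vu Hi] /andP[_ Hj]; apply/eqP; apply: contraNT vu => ij.
apply/eqP/ffunP => k; have [ki|ki] := eqVneq k i.
  by case/orP: Hj => /eqP ->; rewrite ffunE ki (negPf ij).
by case/orP: Hi => /eqP ->; rewrite ffunE (negPf ki).
Qed.

(** Edges are described by the shifts, which are bijections of the torus; sums over
    neighbours thereby become sums over coordinates. *)
Lemma torus_adjE u v : torus_adj u v = [exists i, adj_along i u v].
Proof.
apply: eq_existsb => i; apply/andP/andP.
  move=> [/forallP uv Hi]; split.
    apply/eqP => vu; have := uv i; rewrite vu !eqxx; by [].
  have uvj j : j != i -> v j = u j.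
    by move=> ji; apply/eqP; have := uv j; rewrite (negPf ji) eqbF_neg negbK eq_sym.
  have E (x : 'I_(a i)) (z : 'I_(a i)) : x.+1 == z %[mod a i] -> z = ordS x.
    by move=> /eqP xz; apply: val_inj; rewrite /= xz modn_small.
  case/orP: Hi => /E Hi; apply/orP; [left|right]; apply/eqP/ffunP => j; rewrite ffunE;
    (case: eqP => [->|/eqP /uvj //]); first by [].
  by rewrite Hi ordSK.
move=> [vu Hi].
have uvj j : j != i -> v j = u j.
  by move=> /negPf ji; case/orP: Hi => /eqP ->; rewrite ffunE ji.
split.
  apply/forallP => j; have [->|ji] := eqVneq j i; last by rewrite uvj // eqxx.
  rewrite eqb_id; apply: contraNneq vu => uvi; apply/eqP/ffunP => k.
  by have [->|/uvj //] := eqVneq k i.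
case/orP: Hi => /eqP ->; rewrite ffunE eqxx; apply/orP; [left|right].
  by rewrite /= modn_mod.
by rewrite -{2}(ord_predK (u i)) /= modn_mod.
Qed.

Variable R : realType.
Implicit Types f g : torus a -> R.

(** Halving the degree makes one formula cover cycles of length 1, where both
    shifts are the identity, of length 2, where they coincide, and longer ones. *)
Lemma sum_along i f u :
  \sum_(v | adj_along i u v) f v =
    (cycle_deg (a i))%:R / 2 * (f (shift i u) + f (unshift i u)).
Proof.
have ai : (u i < a i)%N := ltn_ord (u i).
have neq (v w : torus a) : (v i : nat) <> w i -> v != w.
  by move=> vw; apply/eqP => e_vw; apply: vw; rewrite e_vw.
have [a1|a1] := eqVneq (a i) 1%N.
  have s_u : shift i u = u.
    apply/ffunP => j; rewrite ffunE; case: eqP => // ->.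
    by apply: ord_inj; rewrite ordS_val; case: eqP; lia.
  have t_u : unshift i u = u by rewrite -{1}s_u shiftK.
  rewrite a1 /cycle_deg /= mul0r mul0r big1 // => v /andP[].
  by rewrite s_u t_u orbb => /negPf ->.
have s_u : shift i u != u.
  by apply: neq; rewrite shift_at eqxx ordS_val; case: eqP; lia.
have t_u : unshift i u != u.
  by apply: neq; rewrite unshift_at eqxx ord_pred_val; case: eqP; lia.
have [a2|a2] := eqVneq (a i) 2%N.
  have s_t : unshift i u = shift i u.
    apply/ffunP => j; rewrite !ffunE; case: eqP => // ->.
    by apply: ord_inj; rewrite ordS_val ord_pred_val; do 2 case: eqP; lia.
  rewrite (big_pred1 (shift i u)) => [|v]; last first.
    by rewrite /adj_along s_t orbb /=; case: (eqVneq v (shift i u)) => [->|_]; rewrite ?s_u ?andbF.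
  by rewrite s_t a2 (_ : cycle_deg 2 = 1%N) //; field.
have s_t : unshift i u != shift i u.
  apply: neq; rewrite shift_at unshift_at !eqxx ordS_val ord_pred_val.
  by do 2 case: eqP; lia.
rewrite (bigD1 (shift i u)) /=; last by rewrite /adj_along s_u eqxx.
rewrite (big_pred1 (unshift i u)) => [|v /=]; last first.
  rewrite /adj_along; have [->|_] := eqVneq v (unshift i u); first by rewrite t_u s_t orbT.
  by rewrite orbF; case: (v == shift i u); rewrite ?andbF.
by rewrite /cycle_deg (minn_idPl _) ?divff ?mul1r ?pnatr_eq0 //; lia.
Qed.

Lemma sum_neighbours f u :
  \sum_(v | torus_adj u v) f v =
    \sum_i (cycle_deg (a i))%:R / 2 * (f (shift i u) + f (unshift i u)).
Proof.
under [RHS]eq_bigr do rewrite -sum_along big_mkcond /=.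
rewrite exchange_big /= big_mkcond /=; apply: eq_bigr => v _.
rewrite torus_adjE; case: existsP => [[i iuv]|no]; last first.
  by rewrite big1 // => i _; case: ifP => // iuv; case: no; exists i.
rewrite (bigD1 i) //= iuv big1 ?addr0 // => j ji; case: ifP => // juv.
by rewrite (adj_along_inj juv iuv) eqxx in ji.
Qed.

Lemma gdeg_torus u : gdeg (@torus_adj N a) u = torus_deg.
Proof.
apply/eqP; rewrite -(eqr_nat R) /gdeg -sum1_card natr_sum.
rewrite (sum_neighbours (fun=> 1)) /torus_deg natr_sum; apply/eqP.
by apply: eq_bigr => i _; field.
Qed.

(** The unnormalised Laplacian, degree times (1 - P). *)
Definition lap f u : R :=
  \sum_i (cycle_deg (a i))%:R / 2 * (f u *+ 2 - f (shift i u) - f (unshift i u)).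

Lemma step_average f u : (0 < torus_deg)%N ->
  \sum_z step_prob (@torus_adj N a) R u z * f z = f u - lap f u / torus_deg%:R.
Proof.
move=> deg0; have degR : torus_deg%:R != 0 :> R by rewrite pnatr_eq0 -lt0n.
rewrite /step_prob gdeg_torus.
transitivity (torus_deg%:R^-1 * \sum_(v | torus_adj u v) f v).
  rewrite mulr_sumr [RHS]big_mkcond; apply: eq_bigr => z _.
  by case: ifP; rewrite ?mul0r.
apply: (mulfI degR); rewrite mulrA divff // mul1r mulrBr mulrCA divff // mulr1.
rewrite sum_neighbours /torus_deg natr_sum mulr_suml -sumrB.
by apply: eq_bigr => i _; rewrite mulr2n; field.
Qed.

Lemma lapB f g u : lap (fun v => f v - g v) u = lap f u - lap g u.
Proof. by rewrite /lap -sumrB; apply: eq_bigr => i _; ring. Qed.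

(** The Dirichlet form of [lap]; each edge counts once, since along a cycle of
    length 2 the two terms of the sum describe the same edge with weight 1/2. *)
Definition energy f : R :=
  \sum_i (cycle_deg (a i))%:R / 2 * \sum_u (f (shift i u) - f u) ^+ 2.

Lemma sum_shift i f : \sum_u f (shift i u) = \sum_u f u.
Proof.
by rewrite [RHS](reindex (shift i)) //; apply: onW_bij; exists (unshift i);
  [exact: shiftK|exact: unshiftK].
Qed.

Lemma sum_by_parts f g :
  \sum_u f u * lap g u = \sum_i (cycle_deg (a i))%:R / 2 *
     \sum_u (f (shift i u) - f u) * (g (shift i u) - g u).
Proof.
under eq_bigr do rewrite mulr_sumr.
rewrite exchange_big /=; apply: eq_bigr => i _.
under eq_bigr do rewrite mulrCA.
rewrite -mulr_sumr; congr (_ * _).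
have E : \sum_u f u * g (unshift i u) = \sum_u f (shift i u) * g u.
  by rewrite -(sum_shift i); apply: eq_bigr => u _; rewrite shiftK.
have E2 : \sum_u f (shift i u) * g (shift i u) = \sum_u f u * g u.
  exact: (sum_shift i (fun u => f u * g u)).
transitivity (\sum_u (f u * g u) *+ 2 - \sum_u f u * g (shift i u)
   - \sum_u f u * g (unshift i u)).
  by rewrite -!sumrB; apply: eq_bigr => u _; rewrite !mulrBr mulrnAr.
rewrite E sumrMnl mulr2n -{1}E2 -big_split -!sumrB /=.
by apply: eq_bigr => u _; ring.
Qed.

Lemma energyE f : energy f = \sum_u f u * lap f u.
Proof. by rewrite sum_by_parts. Qed.

Lemma energy_ge0 f : 0 <= energy f.
Proof.
apply: sumr_ge0 => i _; rewrite mulr_ge0 ?divr_ge0 ?ler0n //.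
by apply: sumr_ge0 => u _; exact: sqr_ge0.
Qed.

End TorusGraph.

(** * The Green function of a torus by Fourier series *)

Section Green.
Variables (R : realType) (N : nat) (a : 'I_N -> nat).
Implicit Types (i j : 'I_N) (u v k : torus a).
Local Notation cos := (@cos R).
Local Notation pi := (@pi R).

(** The phase of the character of frequency [k] at u - v, up to a multiple
    of 2 pi that depends on the representatives and that cos does not see. *)
Definition phase k u v : R :=
  \sum_i pi *+ 2 * (k i)%:R * ((u i)%:R - (v i)%:R) / (a i)%:R.

Definition angle k i : R := pi *+ 2 * (k i)%:R / (a i)%:R.

Lemma side_gt0 u i : (0 < a i)%N.
Proof. exact: leq_ltn_trans (ltn_ord (u i)). Qed.

Let side_neq0 u i : (a i)%:R != 0 :> R.
Proof. by rewrite pnatr_eq0 -lt0n (side_gt0 u). Qed.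

Lemma cos_period (x : R) (m n : nat) : cos (x + pi *+ 2 *+ m - pi *+ 2 *+ n) = cos x.
Proof.
have per z l : cos (z + pi *+ 2 *+ l) = cos z.
  by elim: l => [|l IHl]; rewrite ?mulr0n ?addr0 // mulrSr addrA cosD2pi.
by rewrite -(per _ n) subrK per.
Qed.

(** The multiple of [n] lost by wrapping around becomes a multiple of 2 pi in a
    phase, where [cos_period] absorbs it. *)
Lemma ordS_wrap n (k : 'I_n) : exists m : nat, ((ordS k)%:R : R) = k%:R + 1 - (m * n)%:R.
Proof.
rewrite ordS_val; case: eqP => [kn|_]; [exists 1%N|exists 0%N].
  by rewrite mul1n natr1 kn subrr.
by rewrite mul0n subr0 natr1.
Qed.

Lemma phaseC k u v : phase k u v = - phase k v u.
Proof. by rewrite -sumrN; apply: eq_bigr => i _; rewrite -opprB mulrN mulNr. Qed.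

Lemma phase_id k u : phase k u u = 0.
Proof. by rewrite /phase big1 // => i _; rewrite subrr mulr0 mul0r. Qed.

Lemma cos_phase_shift_vertex k i u v :
  cos (phase k (shift i u) v) = cos (phase k u v + angle k i).
Proof.
have [m um] := ordS_wrap (u i).
rewrite -[RHS](cos_period _ 0 (k i * m)) mulr0n addr0; congr (cos _).
rewrite /phase (bigD1 i) //= [in RHS](bigD1 i) //= shift_at eqxx um.
rewrite (eq_bigr (fun j => pi *+ 2 * (k j)%:R * ((u j)%:R - (v j)%:R) / (a j)%:R)).
  rewrite /angle -[_ *+ (k i * m)]mulr_natr !natrM; have := side_neq0 u i.
  by move=> ai; field.
by move=> j ji; rewrite shift_at (negPf ji).
Qed.

Lemma cos_phase_unshift_vertex k i u v :
  cos (phase k (unshift i u) v) = cos (phase k u v - angle k i).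
Proof.
have [m um] := ordS_wrap (unshift i u i).
rewrite -[RHS](cos_period _ (k i * m) 0) mulr0n subr0; congr (cos _).
rewrite -{2}(unshiftK i u) /phase (bigD1 i) //= [in RHS](bigD1 i) //=.
rewrite [shift i _ i]shift_at eqxx um.
rewrite [in RHS](eq_bigr (fun j => pi *+ 2 * (k j)%:R *
  ((unshift i u j)%:R - (v j)%:R) / (a j)%:R)).
  rewrite /angle -[_ *+ (k i * m)]mulr_natr !natrM; have := side_neq0 u i.
  by move=> ai; field.
by move=> j ji; rewrite shift_at (negPf ji).
Qed.

Lemma cos_lt1 (n m l : nat) : (m < n)%N -> (l < n)%N -> m != l ->
  cos (pi *+ 2 * (m%:R - l%:R) / n%:R) < 1.
Proof.
move=> mn ln ml; set beta := _ / _.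
have -> : cos beta = cos `|beta| by case: (ger0P beta) => _; rewrite ?cosN.
have n0 : 0 < n%:R :> R by rewrite ltr0n (leq_ltn_trans _ mn).
have d0 : 0 < `|m%:R - l%:R| :> R by rewrite normr_gt0 subr_eq0 eqr_nat.
have dlt : `|m%:R - l%:R| < n%:R :> R.
  have : m%:R < n%:R :> R by rewrite ltr_nat.
  have : l%:R < n%:R :> R by rewrite ltr_nat.
  have : 0 <= m%:R :> R by [].
  have : 0 <= l%:R :> R by [].
  by move=> ? ? ? ?; rewrite ltr_norml; apply/andP; split; lra.
have -> : `|beta| = (pi * (`|m%:R - l%:R| / n%:R)) *+ 2.
  rewrite /beta normrM normrM normfV (gtr0_norm n0).
  have tp : 0 < pi *+ 2 by rewrite pmulrn_lgt0 //; exact: pi_gt0.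
  by rewrite (gtr0_norm tp) !mulr2n; ring.
set t := pi * _; suff s0 : 0 < sin t.
  by have := exprn_gt0 2 s0; rewrite cos_mulr2n cos2sin2; lra.
have p0 := pi_gt0 R; apply: sin_gt0_pi.
by rewrite mulr_gt0 ?divr_gt0 //= gtr_pMr // ltr_pdivrMr // mul1r.
Qed.

Let step_angle i u v : R := pi *+ 2 * ((u i)%:R - (v i)%:R) / (a i)%:R.

Let cos_phase_shift_freq k i u v (c : R) :
  cos (phase (shift i k) u v + c) = cos (phase k u v + step_angle i u v + c).
Proof.
have [m um] := ordS_wrap (k i).
rewrite -[RHS](cos_period _ (v i * m) (u i * m)); congr (cos _).
rewrite /phase (bigD1 i) //= [in RHS](bigD1 i) //= shift_at eqxx um.
rewrite (eq_bigr (fun j => pi *+ 2 * (k j)%:R * ((u j)%:R - (v j)%:R) / (a j)%:R)).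
  rewrite /step_angle -[_ *+ (u i * m)]mulr_natr -[_ *+ (v i * m)]mulr_natr !natrM.
  by have := side_neq0 u i => ai; field.
by move=> j ji; rewrite shift_at (negPf ji).
Qed.

(** Orthogonality of characters.  Shifting the frequency along a coordinate where
    [u] and [v] differ permutes the terms and moves all phases by beta; averaging the
    shifts by beta and by -beta multiplies the sum by cos beta < 1. *)
Lemma cos_phase_sum u v :
  \sum_k cos (phase k u v) = #|torus a|%:R *+ (u == v).
Proof.
have [->|uv] := eqVneq u v.
  by rewrite (eq_bigr (fun=> 1)) ?sumr_const // => k _; rewrite phase_id cos0.
have [i uvi] : exists i, u i != v i.
  by apply/existsP; apply: contraNT uv; rewrite negb_exists => /forallP uv;
    apply/eqP/ffunP => i; apply/eqP; have := uv i; rewrite negbK.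
set S := \sum_k _; set beta := step_angle i u v.
have shiftS : \sum_k cos (phase k u v + beta) = S.
  rewrite /S -(sum_shift i (fun k => cos (phase k u v))).
  apply: eq_bigr => k _; have := cos_phase_shift_freq k i u v 0.
  by rewrite !addr0.
have unshiftS : \sum_k cos (phase k u v - beta) = S.
  rewrite -(sum_shift i); apply: eq_bigr => k _.
  by rewrite cos_phase_shift_freq addrK.
have : S + S = 2 * cos beta * S.
  rewrite -{1}shiftS -{1}unshiftS -big_split mulr_sumr; apply: eq_bigr => k _ /=.
  by rewrite cosD cosB; ring.
suff beta1 : cos beta < 1.
  move=> SS; have /eqP : (1 - cos beta) * S = 0 by lra.
  by rewrite mulf_eq0 subr_eq0 gt_eqF //= => /eqP ->; rewrite mulr0n.
exact: cos_lt1.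
Qed.

Definition lap_eigenvalue k : R := \sum_i (cycle_deg (a i))%:R * (1 - cos (angle k i)).

Lemma lap_cos k u v :
  lap (fun u => cos (phase k u v)) u = lap_eigenvalue k * cos (phase k u v).
Proof.
rewrite /lap /lap_eigenvalue mulr_suml; apply: eq_bigr => i _.
by rewrite cos_phase_shift_vertex cos_phase_unshift_vertex cosD cosB mulr2n; field.
Qed.

Definition constant_freq k := [forall i, k i == 0 :> nat].

(** The expected hitting time of [v] from [u], in the basis of characters. *)
Definition green v u : R :=
  (torus_deg a)%:R * \sum_(k | ~~ constant_freq k) (1 - cos (phase k u v)) / lap_eigenvalue k.

Lemma lap_eigenvalue_ge_along k i :
  (cycle_deg (a i))%:R * (1 - cos (angle k i)) <= lap_eigenvalue k.
Proof.
rewrite /lap_eigenvalue (bigD1 i) //= lerDl; apply: sumr_ge0 => j _.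
by rewrite mulr_ge0 // subr_ge0 cos_le1.
Qed.

Lemma lap_eigenvalue_ge0 k : 0 <= lap_eigenvalue k.
Proof. by apply: sumr_ge0 => j _; rewrite mulr_ge0 // subr_ge0 cos_le1. Qed.

Lemma constant_freq_cos k u v : constant_freq k -> cos (phase k u v) = 1.
Proof.
move=> /forallP k0; rewrite /phase big1 ?cos0 // => i _.
by rewrite (eqP (k0 i)) mulr0 !mul0r.
Qed.

Lemma sum_nonconstant_cos u v :
  \sum_(k | ~~ constant_freq k) cos (phase k u v) = #|torus a|%:R *+ (u == v) - 1.
Proof.
pose k0 : torus a := finfun (fun i => Ordinal (side_gt0 u i)).
have k0E k : constant_freq k = (k == k0).
  apply/forallP/eqP => [k_0|-> i]; last by rewrite ffunE.
  by apply/ffunP => i; rewrite ffunE; apply: val_inj => /=; exact/eqP.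
rewrite -cos_phase_sum [in RHS](bigID (@constant_freq)) /=.
rewrite (big_pred1 k0 k0E) constant_freq_cos ?k0E //.
by rewrite addrAC subrr add0r.
Qed.

Lemma lap_eigenvalue_gt0 k : ~~ constant_freq k -> 0 < lap_eigenvalue k.
Proof.
rewrite negb_forall => /existsP[i ki]; apply: lt_le_trans (lap_eigenvalue_ge_along k i).
have ai := ltn_ord (k i); rewrite mulr_gt0 //.
  by rewrite ltr0n /cycle_deg; move: ki; lia.
rewrite subr_gt0 /angle -[(k i)%:R]subr0 -[X in _ - X](mulr0n 1).
by apply: cos_lt1 => //; exact: leq_ltn_trans ai.
Qed.

(** Each character is an eigenfunction, so dividing by the eigenvalue leaves the sum
    of all characters but the constant one, a point mass at [v] minus 1. *)
Lemma lap_green v u :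
  lap (green v) u = (torus_deg a)%:R * (1 - #|torus a|%:R *+ (u == v)).
Proof.
transitivity (\sum_(k | ~~ constant_freq k) (torus_deg a)%:R *
   - (lap (fun u => cos (phase k u v)) u / lap_eigenvalue k)).
  have split_sum i : green v u *+ 2 - green v (shift i u) - green v (unshift i u) =
      \sum_(k | ~~ constant_freq k) (torus_deg a)%:R * - ((cos (phase k u v) *+ 2
        - cos (phase k (shift i u) v) - cos (phase k (unshift i u) v)) / lap_eigenvalue k).
    rewrite /green -mulrnAr -!mulrBr -sumrMnl -!sumrB mulr_sumr.
    by apply: eq_bigr => k _; rewrite !mulr2n; ring.
  rewrite {1}/lap; under eq_bigr do rewrite split_sum mulr_sumr.
  rewrite exchange_big; apply: eq_bigr => k _; rewrite /lap mulr_suml -sumrN mulr_sumr.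
  by apply: eq_bigr => i _; ring.
rewrite -[1 - _]opprB -sum_nonconstant_cos -sumrN mulr_sumr.
apply: eq_bigr => k /lap_eigenvalue_gt0 kgt; rewrite lap_cos mulrAC divff ?mul1r //.
by rewrite gt_eqF.
Qed.

Lemma green_id u : green u u = 0.
Proof. by rewrite /green big1 ?mulr0 // => k _; rewrite phase_id cos0 subrr mul0r. Qed.

Lemma greenC u v : green u v = green v u.
Proof. by congr (_ * _); apply: eq_bigr => k _; rewrite phaseC cosN. Qed.

Lemma green_ge0 v u : 0 <= green v u.
Proof.
rewrite mulr_ge0 //; apply: sumr_ge0 => k _.
by rewrite divr_ge0 ?lap_eigenvalue_ge0 // subr_ge0 cos_le1.
Qed.

Lemma green_poisson v u : (0 < torus_deg a)%N -> u != v ->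
  green v u = 1 + \sum_z step_prob (@torus_adj N a) R u z * green v z.
Proof.
move=> deg0 /negPf uv; rewrite step_average // lap_green uv mulr0n subr0 mulr1.
by rewrite divff ?pnatr_eq0 -?lt0n // subrKC.
Qed.

(** The potential w = green y - green x has a Laplacian supported on [x] and [y], so
    its energy and its pairing with [f] only involve values at these two points.
    The claim is the nonnegativity of the energy of w - t f at the best t. *)
Lemma dirichlet_principle (f : torus a -> R) (B : R) x y :
  0 < B -> energy f <= B ->
  (torus_deg a)%:R * #|torus a|%:R * (f x - f y) ^+ 2 <= 2 * green y x * B.
Proof.
move=> B0 fB; pose w v := green y v - green x v.
pose D : R := (torus_deg a)%:R * #|torus a|%:R.
have pairw g : \sum_u g u * lap w u = D * (g x - g y).
  transitivity (\sum_u (D * (g u *+ (u == x)) - D * (g u *+ (u == y)))).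
    apply: eq_bigr => u _; rewrite lapB !lap_green -mulrBr /D.
    move: (torus_deg a)%:R (#|torus a|%:R : R) => dg vol.
    by case: (u == x); case: (u == y); rewrite ?mulr1n ?mulr0n; ring.
  rewrite sumrB -!mulr_sumr -mulrBr; congr (_ * (_ - _)).
    by rewrite (bigD1 x) //= eqxx big1 ?addr0 // => u /negPf ->.
  by rewrite (bigD1 y) //= eqxx big1 ?addr0 // => u /negPf ->.
have wxy : w x - w y = 2 * green y x.
  by rewrite /w !green_id (greenC x y); ring.
have quad t : 0 <= D * (2 * green y x) - 2 * t * (D * (f x - f y)) + t ^+ 2 * energy f.
  have := energy_ge0 (fun u => w u - t * f u).
  suff -> : energy (fun u => w u - t * f u) =
      energy w - 2 * t * (\sum_u f u * lap w u) + t ^+ 2 * energy f.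
    by rewrite energyE !pairw wxy.
  have -> : \sum_u f u * lap w u = \sum_i (cycle_deg (a i))%:R / 2 *
     \sum_u (f (shift i u) - f u) * (w (shift i u) - w u) by rewrite sum_by_parts.
  rewrite /energy !mulr_sumr -sumrB -big_split; apply: eq_bigr => i _ /=.
  rewrite !(mulrCA _ (_ / 2)) -mulrBr -mulrDr; congr (_ * _).
  rewrite !mulr_sumr -sumrB -big_split; apply: eq_bigr => u _ /=; ring.
have D0 : 0 <= D by rewrite mulr_ge0.
rewrite -/D; have [->|Dn0] := eqVneq D 0.
  by rewrite mul0r mulr_ge0 ?(ltW B0) // mulr_ge0 // green_ge0.
have {D0} Dgt : 0 < D by rewrite lt_neqAle eq_sym Dn0.
(* The minimiser of the quadratic, with the energy of [f] replaced by its bound. *)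
have := quad (D * (f x - f y) / B).
set E := energy f in fB *; set G := green y x; set F := f x - f y => q.
have : (D * F / B) ^+ 2 * E <= (D * F / B) ^+ 2 * B by rewrite ler_wpM2l ?sqr_ge0.
move=> q2; have {q2}q : 0 <= D * (2 * G) - 2 * (D * F / B) * (D * F) + (D * F / B) ^+ 2 * B.
  by apply: le_trans q _; rewrite lerD2l.
rewrite -(ler_pM2l Dgt) -subr_ge0.
suff -> : D * (2 * G * B) - D * (D * F ^+ 2) =
   B * (D * (2 * G) - 2 * (D * F / B) * (D * F) + (D * F / B) ^+ 2 * B).
  by rewrite mulr_ge0 // ltW.
by field; rewrite gt_eqF.
Qed.

End Green.

(** * Distances on a cycle *)

Section CycleDistance.

Definition cyc_dist n k l := minn ((k - l) + (l - k)) (n - ((k - l) + (l - k))).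

Lemma card_ord_interval n l r : (#|[pred c : 'I_n | l <= c < r]| <= r - l)%N.
Proof.
rewrite cardE -(size_map val) -(size_iota l (r - l)).
apply: uniq_leq_size => [|c]; first by rewrite (map_inj_uniq val_inj) enum_uniq.
move=> /mapP[i]; rewrite mem_enum inE /= => H ->; rewrite mem_iota /=; lia.
Qed.

Lemma card_cyc_ball n y j : (y < n)%N ->
  (#|[pred c : 'I_n | cyc_dist n c y <= j]| <= 4 * j + 1)%N.
Proof.
move=> yn.
have bound l r : (#|[set c : 'I_n | l <= c < r]| <= r - l)%N.
  by rewrite cardsE; exact: card_ord_interval.
have -> : #|[pred c : 'I_n | cyc_dist n c y <= j]%N| =
    #|[set c : 'I_n | cyc_dist n c y <= j]%N| by rewrite cardsE.
set A := [set c : 'I_n | y - j <= c < y + j + 1]%N.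
set B := [set c : 'I_n | y + n - j <= c < n]%N.
set C := [set c : 'I_n | 0 <= c < y + j + 1 - n]%N.
have ABC : [set c : 'I_n | cyc_dist n c y <= j]%N \subset A :|: B :|: C.
  apply/fintype.subsetP => c; rewrite !inE /cyc_dist; have := ltn_ord c.
  by rewrite /minn; case: ifP; lia.
have := bound (y - j)%N (y + j + 1)%N; have := bound (y + n - j)%N n.
have := bound 0%N (y + j + 1 - n)%N; rewrite -/A -/B -/C.
have := subset_leq_card ABC; have [] := leq_card_setU (A :|: B) C.
have [] := leq_card_setU A B. lia.
Qed.

Lemma card_cyc_sphere (n y j : nat) : (y < n)%N ->
  (#|[pred c : 'I_n | cyc_dist n c y == j]| <= 4)%N.
Proof.
move=> yn; rewrite cardE -(size_map val).
apply: (@uniq_leq_size _ _ [:: y + j; y - j; y + n - j; y + j - n])%N => [|c].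
  by rewrite (map_inj_uniq val_inj) enum_uniq.
move=> /mapP[i]; rewrite mem_enum !inE /cyc_dist /= => + ->; have := ltn_ord i.
by rewrite /minn; case: ifP; lia.
Qed.

Lemma cyc_dist_step n y (c : 'I_n) : (y < n)%N ->
  (cyc_dist n (ordS c) y <= (cyc_dist n c y).+1)%N /\
  (cyc_dist n c y <= (cyc_dist n (ordS c) y).+1)%N.
Proof.
move=> yn; have := ltn_ord c; rewrite ordS_val /cyc_dist /minn.
by case: eqP; do 2 case: ifP; lia.
Qed.

(** What lets a walk on the torus decrease a coordinate distance at every step. *)
Lemma cyc_dist_towards n y (c : 'I_n) : (y < n)%N -> c != y :> nat ->
  cyc_dist n c y = (cyc_dist n (ordS c) y).+1 \/
  cyc_dist n c y = (cyc_dist n (ord_pred c) y).+1.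
Proof.
move=> yn; have := ltn_ord c; rewrite ordS_val ord_pred_val /cyc_dist /minn => cn cy.
suff : (if (c - y + (y - c) < n - (c - y + (y - c)))%N
        then (c - y + (y - c))%N else (n - (c - y + (y - c)))%N) =
       (cyc_dist n (if c.+1 == n then 0 else c.+1) y).+1 \/
       (if (c - y + (y - c) < n - (c - y + (y - c)))%N
        then (c - y + (y - c))%N else (n - (c - y + (y - c)))%N) =
       (cyc_dist n (if c == 0 :> nat then n.-1 else c.-1) y).+1.
  by [].
rewrite /cyc_dist /minn.
have [|] := eqVneq c.+1 n; have [|] := eqVneq (c : nat) 0%N; do 3 case: ifP; lia.
Qed.

Lemma cyc_dist_eq0 n k l : (k < n)%N -> (l < n)%N -> (cyc_dist n k l == 0%N) = (k == l).
Proof. by move=> kn ln; rewrite /cyc_dist /minn; case: ifP; lia. Qed.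

Lemma cyc_dist_le n k l : ((cyc_dist n k l).*2 <= n)%N.
Proof. by rewrite /cyc_dist /minn; case: ifP; lia. Qed.

Lemma cyc_dist_le_side n k l : (cyc_dist n k l <= n)%N.
Proof. by have := cyc_dist_le n k l; lia. Qed.

End CycleDistance.

(** * A spectral estimate of the Green function *)

Section SpectralGap.
Variable R : realType.
Local Notation cos := (@cos R).
Local Notation sin := (@sin R).
Local Notation pi := (@pi R).

Lemma norm_sin_muln (x : R) n : `|sin (x *+ n)| <= n%:R * `|sin x|.
Proof.
elim: n => [|n IHn]; first by rewrite mulr0n sin0 normr0 mul0r.
rewrite mulrS sinD -natr1 mulrDl mul1r (le_trans (ler_normD _ _)) //.
rewrite addrC !normrM; apply: lerD.
  by apply: le_trans IHn; rewrite ler_piMl // ler_norml cos_le1 cos_geN1.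
by rewrite ler_piMr // ler_norml cos_le1 cos_geN1.
Qed.

Lemma versin_muln (x : R) n : 1 - cos (x *+ n) <= n%:R ^+ 2 * (1 - cos x).
Proof.
have versin z : 1 - cos z = `|sin (z / 2)| ^+ 2 *+ 2.
  have {1}-> : z = (z / 2) *+ 2 by rewrite mulr2n; lra.
  by rewrite cos_mulr2n cos2sin2 real_normK ?num_real // mulrnBl; lra.
rewrite !versin mulrnAr -exprMn lerMn2r /= lerXn2r ?nnegrE ?mulr_ge0 //.
by rewrite mulrnAl norm_sin_muln.
Qed.

(** Some multiple n0 t with n0 <= n lands in the half circle where cos is
    nonpositive, because the steps t are at most pi. *)
Lemma versin_lower (t : R) n : 0 < t -> t <= pi -> pi / 2 <= t *+ n ->
  1 <= n%:R ^+ 2 * (1 - cos t).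
Proof.
move=> t0 tpi tn; have p0 : 0 < pi := pi_gt0 R.
have : exists m, pi / 2 <= t *+ m by exists n.
case/ex_minnP => m tm mmin; have mn := mmin n tn.
case: m tm mmin mn => [|m] tm mmin mn; first by rewrite mulr0n in tm; lra.
have tm' : t *+ m < pi / 2.
  by rewrite ltNge; apply/negP => /mmin; rewrite ltnn.
have cm : cos (t *+ m.+1) <= 0.
  rewrite -oppr_ge0 -sinBpihalf; apply: sin_ge0_pi.
  by rewrite (mulrSr t) in tm *; apply/andP; split; lra.
apply: (@le_trans _ _ (1 - cos (t *+ m.+1))); first by lra.
apply: le_trans (versin_muln _ _) _; apply: ler_wpM2r.
  by rewrite subr_ge0 cos_le1.
by rewrite lerXn2r ?nnegrE // ler_nat.
Qed.

(** A lower bound by m^-2 for 1 - cos at frequency [c]: [c] may be replaced by its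
    distance to 0 on the cycle, which puts the angle in the interval from 0 to pi. *)
Lemma versin_freq (n c m : nat) : (c < n)%N -> (n <= 4 * (m * cyc_dist n c 0))%N ->
  1 <= m%:R ^+ 2 * (1 - cos (pi *+ 2 * c%:R / n%:R)).
Proof.
move=> cn nm; have n0 : 0 < n%:R :> R by rewrite ltr0n; lia.
have p0 : 0 < pi := pi_gt0 R.
have q2 := cyc_dist_le n c 0; set q := cyc_dist n c 0 in nm q2.
have q0 : (0 < q)%N by rewrite lt0n; apply/eqP => q0; move: nm; rewrite q0; lia.
have -> : cos (pi *+ 2 * c%:R / n%:R) = cos (pi *+ 2 * q%:R / n%:R).
  have [->|qn] : q = c \/ q = (n - c)%N.
    by rewrite /q /cyc_dist /minn; case: ifP; lia.
  - by [].
  - rewrite qn natrB ?(ltnW cn) // -[RHS]cosN -[RHS]cosD2pi; congr (cos _).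
    by field; rewrite gt_eqF.
have nq : n%:R <= 4 * (m%:R * q%:R) :> R by rewrite -!natrM ler_nat.
have qn : q%:R *+ 2 <= n%:R :> R by rewrite -mulr_natr -natrM ler_nat muln2.
have qR : 0 < q%:R :> R by rewrite ltr0n.
apply: versin_lower.
- by rewrite divr_gt0 // mulr_gt0 // mulr2n; lra.
- by rewrite ler_pdivrMr // mulrnAl -mulrnAr ler_pM2l.
- have -> : pi *+ 2 * q%:R / n%:R *+ m = pi * (2 * m%:R * q%:R) / n%:R.
    by rewrite -mulr_natr mulr2n; field; rewrite gt_eqF.
  by rewrite ler_pdivlMr //; have := ler_wpM2l (ltW p0) nq; lra.
Qed.

Variables (N : nat) (a : 'I_N -> nat).
Implicit Types (i : 'I_N) (k u v : torus a).

Lemma lap_eigenvalue_lower k i m : (a i <= 4 * (m * cyc_dist (a i) (k i) 0))%N ->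
  1 <= m%:R ^+ 2 * lap_eigenvalue R k.
Proof.
move=> km; have ki := ltn_ord (k i).
have := versin_freq ki km; rewrite -[X in cos X]/(angle R k i) => /le_trans; apply.
apply: ler_wpM2l; first exact: sqr_ge0.
apply: le_trans (lap_eigenvalue_ge_along _ k i); rewrite ler_peMl ?subr_ge0 ?cos_le1 //.
have q0 : (0 < cyc_dist (a i) (k i) 0)%N.
  by rewrite lt0n; apply/eqP => q0; move: km; rewrite q0; lia.
rewrite ler1n /cycle_deg; have := cyc_dist_le (a i) (k i) 0.
by rewrite /minn; case: ifP; lia.
Qed.

Lemma nonconstantP k : ~~ constant_freq k -> exists i, (0 < cyc_dist (a i) (k i) 0)%N.
Proof.
rewrite negb_forall => /existsP[i ki]; exists i; rewrite lt0n.
by rewrite cyc_dist_eq0 // (leq_ltn_trans _ (ltn_ord (k i))).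
Qed.

Lemma sum_below n : (\sum_(1 <= m < n.+1) 4 * m = 2 * n * n.+1)%N.
Proof.
elim: n => [|n IHn]; first by rewrite big_nil.
by rewrite big_nat_recr //= IHn; lia.
Qed.

(** Layer cake: if n is the least scale at which [k] leaves the box of radii
    a_i / n, the eigenvalue is at least n^-2, and n^2 is at most the sum of 4 m
    over the smaller scales m. *)
Lemma inv_lap_eigenvalue_le k A : (forall i, a i <= A)%N -> ~~ constant_freq k ->
  (lap_eigenvalue R k)^-1 <=
  (\sum_(1 <= m < A.+1 | [forall i, m * cyc_dist (a i) (k i) 0 <= a i]) 4 * m)%N%:R.
Proof.
move=> aA kn; have eig0 := lap_eigenvalue_gt0 R kn.
pose Q m := [forall i, m * cyc_dist (a i) (k i) 0 <= a i]%N.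
have QA : ~~ Q A.+1.
  have [i ki] := nonconstantP kn; rewrite negb_forall; apply/existsP; exists i.
  by have := aA i; nia.
have : exists n, ~~ Q n by exists A.+1.
case/ex_minnP => n /forallPn[i ni] nmin.
have nA := nmin _ QA; have n2 : (2 <= n)%N.
  case: n ni {nmin nA} => [|[|n]] //; have := cyc_dist_le (a i) (k i) 0; lia.
have small m : (m < n)%N -> Q m.
  by move=> mn; apply/negPn/negP => /nmin; rewrite leqNgt mn.
have eign : 1 <= n%:R ^+ 2 * lap_eigenvalue R k by apply: (lap_eigenvalue_lower (i := i)); lia.
apply: (@le_trans _ _ (n ^ 2)%N%:R).
  by rewrite natrX -[_^-1]mul1r ler_pdivrMr.
rewrite ler_nat (big_cat_nat (n := n)) ?(ltnW n2) //= -/(Q _).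
apply: leq_trans (leq_addr _ _).
rewrite big_nat_cond (eq_bigl (fun m => 1 <= m < n)%N) => [|m]; last first.
  by case/boolP: (1 <= m < n)%N => //= /andP[_ /small].
by rewrite -big_nat; case: n n2 {ni nmin nA small eign} => // n n2; rewrite sum_below; nia.
Qed.

Lemma card_box (F : forall i, pred 'I_(a i)) :
  #|[pred k : torus a | [forall i, F i (k i)]]| = (\prod_i #|F i|)%N.
Proof.
have -> : #|[pred k : torus a | [forall i, F i (k i)]]| =
    #|(family F : simpl_pred (torus a))|.
  by apply: eq_card => k; rewrite !inE.
by rewrite card_family foldrE big_map big_enum.
Qed.

(** Bounding 1 - cos by 2 and exchanging the sums over frequencies and scales; at
    each scale the frequencies that remain form a box. *)
Lemma green_le u v A : (forall i, a i <= A)%N ->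
  green R v u <= 8 * (torus_deg a)%:R *
    (\sum_(1 <= m < A.+1) m * \prod_i (4 * (a i %/ m) + 1))%N%:R.
Proof.
move=> aA; rewrite /green -mulrA [X in _ <= X]mulrCA; apply: ler_wpM2l => //.
apply: (@le_trans _ _ (\sum_(k : torus a) 2 *
  (\sum_(1 <= m < A.+1 | [forall i, m * cyc_dist (a i) (k i) 0 <= a i]) 4 * m)%N%:R)).
  rewrite [X in X <= _]big_mkcond; apply: ler_sum => k _; case: ifP => [kn|_].
    apply: ler_pM; first by rewrite subr_ge0 cos_le1.
    - by rewrite invr_ge0 lap_eigenvalue_ge0.
    - by have := cos_geN1 (phase R k u v); lra.
    - exact: inv_lap_eigenvalue_le.
  by rewrite mulr_ge0.
rewrite -mulr_sumr -natr_sum -!natrM ler_nat.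
rewrite -[8%N]/(2 * 4)%N -mulnA leq_mul2l /=.
under eq_bigr do rewrite big_mkcond /=.
rewrite exchange_big /= big_distrr /=; rewrite big_nat_cond [X in (_ <= X)%N]big_nat_cond.
apply: leq_sum => m; rewrite andbT => /andP[m1 mA].
rewrite -big_mkcond sum_nat_const mulnC -mulnA leq_mul2l leq_mul2l; apply/orP; right.
apply/orP; right.
rewrite (card_box (fun i c => m * cyc_dist (a i) c 0 <= a i)%N).
apply: leq_prod => i _.
have [a0|a0] := posnP (a i).
  by apply: leq_trans (max_card _) _; rewrite card_ord a0.
apply: leq_trans (card_cyc_ball _ a0); apply: subset_leq_card; apply/fintype.subsetP => c.
by rewrite !inE leq_divRL // mulnC.
Qed.

End SpectralGap.

(** * Summation over the scales *)

Section ScaleSum.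
Variable R : realType.

(** Comparable with the number of frequencies on a cycle of length [n] at scale [m];
    the truncation at 1 accounts for the constant frequency. *)
Definition clipped m n := maxn 1 (n %/ m).

Lemma clipped1 m : clipped m 1 = 1%N.
Proof. by apply/maxn_idPl; exact: leq_div. Qed.

Let clipped_ge m n : (0 < m)%N -> (m <= n)%N -> (clipped m n)%:R <= n%:R / m%:R :> R.
Proof.
move=> m0 mn; rewrite ler_pdivlMr ?ltr0n // -natrM ler_nat /clipped.
by rewrite (maxn_idPr _) ?divn_gt0 // leq_divM.
Qed.

Let clipped_lt m n : (n < m)%N -> clipped m n = 1%N.
Proof. by move=> nm; rewrite /clipped divn_small. Qed.

Lemma sum_inv_sq C : \sum_(1 <= m < C.+1) (m%:R ^+ 2)^-1 <= 2 :> R.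
Proof.
suff H : forall n, \sum_(1 <= m < n.+2) (m%:R ^+ 2)^-1 <= 2 - n.+1%:R^-1 :> R.
  case: C => [|C]; first by rewrite big_nil.
  by apply: le_trans (H C) _; rewrite gerBl.
elim=> [|n IHn]; first by rewrite big_nat1 expr1n; lra.
rewrite big_nat_recr //=; apply: le_trans (lerD IHn (lexx _)) _.
have n0 : 0 < n.+1%:R :> R by [].
rewrite -[n.+2]addn1 natrD; set x : R := n.+1%:R in n0 *.
rewrite -subr_ge0 (_ : _ - _ = (x * (x + 1) ^+ 2)^-1); last first.
  by field; rewrite !gt_eqF //; lra.
by rewrite invr_ge0 mulr_ge0 ?sqr_ge0 // ltW.
Qed.

Lemma sum_inv_le_ln C B : (0 < C)%N -> (C <= B)%N ->
  \sum_(C.+1 <= m < B.+1) m%:R^-1 <= ln (B%:R / C%:R) :> R.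
Proof.
move=> C0; elim: B => [|B IHB]; first by rewrite leqn0 => /eqP C0'; rewrite C0' in C0.
rewrite leq_eqVlt => /orP[/eqP <-|CB].
  by rewrite big_geq // divff ?ln1 // pnatr_eq0 -lt0n.
rewrite big_nat_recr //=; apply: le_trans (lerD (IHB CB) (lexx _)) _.
have B0 : 0 < B%:R :> R by rewrite ltr0n; lia.
have C0' : 0 < C%:R :> R by rewrite ltr0n.
rewrite !ln_div ?posrE // addrAC lerD2r -lerBrDl -[X in X <= _]opprK lerNl.
rewrite opprB -ln_div ?posrE //.
have -> : B%:R / B.+1%:R = 1 + (- B.+1%:R^-1) :> R.
  by rewrite -[B.+1]addn1 natrD; field; rewrite gt_eqF //; lra.
apply: le_ln1Dx; rewrite ltrN2 invf_lt1 // -[B.+1]addn1 natrD; lra.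
Qed.

(** Scales below [C] see a lattice of dimension at least three, scales between [C]
    and [B] see a plane, and scales between [B] and [A] see a line; their sums give
    the volume, the logarithm and the square. *)
Lemma clipped_sum A B C (r : seq nat) : (0 < C)%N -> (C <= B)%N -> (B <= A)%N ->
  all (fun t => 0 < t <= C)%N r ->
  (\sum_(1 <= m < A.+1) m *
     (clipped m A * (clipped m B * (clipped m C * \prod_(t <- r) clipped m t))))%N%:R
  <= 2 * (A * (B * (C * \prod_(t <- r) t)))%N%:R
     + A%:R * B%:R * ln (B%:R / C%:R) + A%:R ^+ 2 :> R.
Proof.
move=> C0 CB BA rC; set F := BIG_F.
have -> : (\sum_(1 <= m < A.+1) F m =
    \sum_(1 <= m < C.+1) F m + \sum_(C.+1 <= m < B.+1) F m + \sum_(B.+1 <= m < A.+1) F m)%N.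
  by rewrite -addnA -!big_cat_nat //=; lia.
have big m : (C < m)%N -> (\prod_(t <- r) clipped m t = 1)%N.
  move=> Cm; rewrite big1_seq // => t /andP[_ /(allP rC) /andP[_ tC]].
  by rewrite clipped_lt // (leq_ltn_trans tC).
rewrite !natrD; apply: lerD; first apply: lerD.
- apply: le_trans (_ : _ <= (A * (B * (C * \prod_(t <- r) t)))%N%:R *
      \sum_(1 <= m < C.+1) (m%:R ^+ 2)^-1) _; last first.
    by rewrite mulrC ler_wpM2r // sum_inv_sq.
  rewrite natr_sum mulr_sumr big_nat_cond [X in _ <= X]big_nat_cond.
  apply: ler_sum => m; rewrite andbT ltnS => /andP[m0 mC].
  have mR : 0 < m%:R :> R by rewrite ltr0n.
  have cR n : (m <= n)%N -> (clipped m n)%:R <= n%:R / m%:R :> R by exact: clipped_ge.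
  have Pr : (\prod_(t <- r) clipped m t)%N%:R <= (\prod_(t <- r) t)%N%:R :> R.
    rewrite ler_nat big_seq [X in (_ <= X)%N]big_seq; apply: leq_prod => t /(allP rC) /andP[t0 _].
    by rewrite geq_max t0 leq_div.
  have mB := leq_trans mC CB; have mA := leq_trans mB BA.
  rewrite /F !natrM; apply: (@le_trans _ _ (m%:R * (A%:R / m%:R *
     (B%:R / m%:R * (C%:R / m%:R * (\prod_(t <- r) t)%N%:R))))).
    apply: ler_wpM2l => //; apply: ler_pM => //; first exact: cR.
    apply: ler_pM => //; first exact: cR.
    by apply: ler_pM => //; exact: cR.
  by rewrite le_eqVlt; apply/predU1P; left; field; rewrite gt_eqF.
- apply: le_trans (_ : _ <= A%:R * B%:R * \sum_(C.+1 <= m < B.+1) m%:R^-1) _; last first.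
    by apply: ler_wpM2l => //; exact: sum_inv_le_ln.
  rewrite natr_sum mulr_sumr big_nat_cond [X in _ <= X]big_nat_cond.
  apply: ler_sum => m; rewrite andbT ltnS => /andP[Cm mB].
  have m0 : (0 < m)%N by lia.
  have mR : 0 < m%:R :> R by rewrite ltr0n.
  rewrite /F big // (clipped_lt Cm) !muln1 !natrM.
  apply: (@le_trans _ _ (m%:R * (A%:R / m%:R * (B%:R / m%:R)))).
    apply: ler_wpM2l => //; apply: ler_pM => //; last exact: clipped_ge.
    by apply: clipped_ge => //; lia.
  by rewrite le_eqVlt; apply/predU1P; left; field; rewrite gt_eqF.
- rewrite -natrX ler_nat big_nat_cond.
  apply: leq_trans (_ : (\sum_(B.+1 <= m < A.+1) A <= _)%N); last first.
    by rewrite sum_nat_const_nat; nia.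
  rewrite [X in (_ <= X)%N]big_nat_cond; apply: leq_sum => m.
  rewrite andbT ltnS => /andP[Bm mA].
  have Cm : (C < m)%N by lia.
  rewrite /F big // (clipped_lt Bm) (clipped_lt Cm).
  by rewrite !muln1 /clipped (maxn_idPr _) ?divn_gt0 ?(mulnC m) ?leq_divM //; lia.
Qed.

End ScaleSum.

Section UpperBound.
Variables (R : realType) (N : nat) (a : 'I_N -> nat).
Hypothesis sides : torus_sides a.

(** Missing sides count as 1, so that all dimensions are treated as at least 3. *)
Lemma prod_top_sides (f : nat -> nat) : f 1%N = 1%N ->
  (\prod_i f (a i) = f (top_side a 0) * (f (top_side a 1) * (f (top_side a 2) *
     \prod_(t <- drop 3 (rev (codom a))) f t)))%N.
Proof.
move=> f1; have -> : (\prod_i f (a i) = \prod_(t <- rev (codom a)) f t)%N.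
  by rewrite big_rev big_map big_enum.
rewrite /top_side; case: (rev _) => [|x [|y [|z r]]] /=;
  by rewrite ?drop0 ?big_cons ?big_nil ?f1 ?muln1.
Qed.

Lemma top_sides_sorted : sorted geq (rev (codom a)).
Proof.
rewrite rev_sorted /codom /image_mem sorted_map.
have : sorted (fun i j : 'I_N => i <= j)%N (enum 'I_N).
  have := iota_sorted 0 N; rewrite -val_enum_ord sorted_map.
  by apply: sub_sorted.
by apply: sub_sorted => i j /=; case: sides => _; apply.
Qed.

Lemma top_side_gt0 k : (0 < top_side a k)%N.
Proof.
rewrite /top_side; have [kN|Nk] := ltnP k (size (rev (codom a))); last by rewrite nth_default.
have := mem_nth 1%N kN; rewrite mem_rev => /mapP[i _ ->]; by case: sides.
Qed.

Lemma top_sides_order :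
  [/\ (0 < top_side a 2)%N, (top_side a 2 <= top_side a 1)%N,
      (top_side a 1 <= top_side a 0)%N,
      all (fun t => 0 < t <= top_side a 2)%N (drop 3 (rev (codom a)))
    & forall i, (a i <= top_side a 0)%N].
Proof.
have pos k := top_side_gt0 k; split => //.
- have := pos 1%N; have := top_sides_sorted; rewrite /top_side.
  by case: (rev _) => [|x [|y [|z r]]] //= /and3P[].
- have := pos 0%N; have := top_sides_sorted; rewrite /top_side.
  by case: (rev _) => [|x [|y r]] //= /andP[].
- apply/allP => t tr; apply/andP; split.
    have /mapP[i _ ->] : t \in codom a by rewrite -mem_rev; exact: mem_drop tr.
    by case: sides.
  move: tr; have := top_sides_sorted; rewrite /top_side.
  case: (rev _) => [|x [|y [|z r]]] //= /and3P[_ _]; rewrite drop0.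
  by move=> zr tr; have /allP/(_ t tr) := order_path_min (rev_trans leq_trans) zr.
- move=> i; have : a i \in rev (codom a) by rewrite mem_rev codom_f.
  have := top_sides_sorted; rewrite /top_side.
  case: (rev _) => [|x r] //= xr; rewrite inE => /orP[/eqP -> //|ir].
  by have /allP/(_ _ ir) := order_path_min (rev_trans leq_trans) xr.
Qed.

Lemma torus_deg_le : (torus_deg a <= N * 2)%N.
Proof.
rewrite -[X in (_ <= X * 2)%N]card_ord -sum_nat_const; apply: leq_sum => i _.
exact: geq_minl.
Qed.

Lemma green_upper (u v : torus a) :
  green R v u <= (16 * N * 5 ^ N)%N%:R * 4 * hitting_scale R a.
Proof.
have [C0 CB BA rC aA] := top_sides_order.
set F := hitting_scale R a.
apply: le_trans (green_le R u v aA) _.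
have degR : (torus_deg a)%:R <= N%:R * 2 :> R by rewrite -natrM ler_nat torus_deg_le.
have sumR : (\sum_(1 <= m < (top_side a 0).+1) m * \prod_i (4 * (a i %/ m) + 1))%N%:R
    <= (5 ^ N)%N%:R * (4 * F).
  apply: (@le_trans _ _ ((5 ^ N * \sum_(1 <= m < (top_side a 0).+1) m *
      \prod_i clipped m (a i))%N%:R)).
    rewrite ler_nat big_distrr /=; apply: leq_sum => m _.
    rewrite mulnCA leq_mul2l; apply/orP; right.
    rewrite -[X in (5 ^ X)%N](card_ord N) -prod_nat_const -big_split /=.
    apply: leq_prod => i _; rewrite /clipped; lia.
  rewrite natrM ler_wpM2l //.
  under eq_bigr do rewrite (prod_top_sides (clipped1 _)).
  apply: le_trans (clipped_sum R C0 CB BA rC) _.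
  rewrite -(prod_top_sides (f := id)) //.
  have F1 : (\prod_i a i)%N%:R <= F by rewrite /F /hitting_scale le_max lexx.
  have F2 : (top_side a 0)%:R * (top_side a 1)%:R
         * ln ((top_side a 1)%:R / (top_side a 2)%:R) <= F.
    by rewrite /F /hitting_scale !le_max lexx orbT.
  have F3 : (top_side a 0)%:R ^+ 2 <= F by rewrite /F /hitting_scale !le_max lexx !orbT.
  by lra.
apply: le_trans (ler_wpM2l _ sumR) _; first by rewrite mulr_ge0.
have F0 : 0 <= F by rewrite /F /hitting_scale le_max ler0n.
apply: (@le_trans _ _ (8 * (N%:R * 2) * ((5 ^ N)%N%:R * (4 * F)))).
  apply: ler_wpM2r; first by rewrite !mulr_ge0.
  by rewrite ler_wpM2l.
by rewrite le_eqVlt; apply/predU1P; left; rewrite !natrM; ring.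
Qed.

End UpperBound.

(** * Test functions for the Dirichlet principle *)

Section LowerBounds.
Variables (R : realType) (N : nat) (a : 'I_N -> nat).
Hypothesis deg_gt0 : (0 < torus_deg a)%N.
Implicit Types (i j p q : 'I_N) (x y u v : torus a).

Lemma card_torus : #|torus a| = (\prod_i a i)%N.
Proof.
have -> : (\prod_i a i = \prod_i #|(predT : pred 'I_(a i))|)%N.
  by apply: eq_bigr => i _; rewrite -[LHS]card_ord.
rewrite -(card_box (fun i => predT)); apply: eq_card => u; rewrite !inE.
exact/esym/forallP.
Qed.

(** The degree cancels when the energy is bounded direction by direction. *)
Lemma dirichlet_bound (f : torus a -> R) (B : R) x y : 0 < B ->
  (forall j, \sum_u (f (shift j u) - f u) ^+ 2 <= B *+ 2) ->
  #|torus a|%:R * (f x - f y) ^+ 2 <= 2 * green R y x * B.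
Proof.
move=> B0 fB; have degR : 0 < (torus_deg a)%:R :> R by rewrite ltr0n.
rewrite -(ler_pM2l degR) mulrA.
apply: (@le_trans _ _ (2 * green R y x * ((torus_deg a)%:R * B))).
  apply: dirichlet_principle; first exact: mulr_gt0.
  rewrite /energy /torus_deg natr_sum mulr_suml; apply: ler_sum => j _.
  rewrite -mulrA ler_wpM2l //; have := fB j; rewrite -mulr_natr; lra.
by rewrite mulrCA.
Qed.

(** Test function: the indicator of [x]. *)
Lemma green_ge_volume x y : x != y -> #|torus a|%:R <= 2 * green R y x.
Proof.
move=> /negPf xy; pose f u : R := (u == x)%:R.
have := @dirichlet_bound f 1 x y ltr01; rewrite /f eqxx eq_sym xy subr0 expr1n !mulr1.
apply=> j; apply: (@le_trans _ _ (\sum_u (f (shift j u) + f u))).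
  by apply: ler_sum => u _; rewrite /f; do 2 case: eqP => _; rewrite /=; lra.
have f1 : \sum_u f u = 1.
  by rewrite (bigD1 x) //= /f eqxx big1 ?addr0 // => u /negPf ->.
by rewrite big_split /= (sum_shift j f) f1.
Qed.

Lemma cyc_dist_shift i j u y :
  (cyc_dist (a i) (shift j u i) (y i) <= (cyc_dist (a i) (u i) (y i)).+1)%N /\
  (cyc_dist (a i) (u i) (y i) <= (cyc_dist (a i) (shift j u i) (y i)).+1)%N.
Proof.
rewrite shift_at; case: eqP => _; last by [].
exact: cyc_dist_step (ltn_ord (y i)).
Qed.

(** Test function: the distance to [y] along one coordinate, which is Lipschitz. *)
Lemma green_ge_square i x y :
  (cyc_dist (a i) (x i) (y i))%:R ^+ 2 <= 2 * green R y x.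
Proof.
pose f u : R := (cyc_dist (a i) (u i) (y i))%:R.
have vol0 : 0 < #|torus a|%:R :> R by rewrite ltr0n; apply/card_gt0P; exists x.
rewrite -(ler_pM2l vol0) [X in _ <= X]mulrC.
have -> : (cyc_dist (a i) (x i) (y i))%:R = f x - f y.
  by rewrite /f; have /eqP -> : cyc_dist (a i) (y i) (y i) == 0%N;
    rewrite ?subr0 // cyc_dist_eq0 ?ltn_ord.
apply: dirichlet_bound => // j.
apply: (@le_trans _ _ (\sum_(u : torus a) 1)); last first.
  by rewrite sumr_const; have : 0 <= #|torus a|%:R :> R by []; rewrite -mulr_natr; lra.
apply: ler_sum => u _; rewrite /f; have [] := cyc_dist_shift i j u y.
move: (cyc_dist _ _ _) (cyc_dist _ _ _) => m n mn nm.
have : m%:R <= n%:R + 1 :> R by rewrite natr1 ler_nat.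
have : n%:R <= m%:R + 1 :> R by rewrite natr1 ler_nat.
move=> h1 h2; rewrite -subr_ge0 -(expr1n _ 2) subr_sqr.
by apply: mulr_ge0; lra.
Qed.

Definition harmonic_sum n : R := \sum_(1 <= m < n.+1) m%:R^-1.

Lemma ln_le_harmonic_sum n : ln n.+1%:R <= harmonic_sum n.
Proof.
elim: n => [|n IHn]; first by rewrite ln1 /harmonic_sum big_nil.
rewrite /harmonic_sum big_nat_recr //=; apply: le_trans (lerD IHn (lexx _)).
have n0 : 0 < n.+1%:R :> R by [].
rewrite addrC -lerBlDr -ln_div ?posrE //.
have -> : n.+2%:R / n.+1%:R = 1 + n.+1%:R^-1 :> R.
  by rewrite -[n.+2]addn1 natrD; field; rewrite gt_eqF.
by apply: le_ln1Dx; apply: lt_trans (ltrN10 _) _; rewrite invr_gt0.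
Qed.

Lemma card_two_coords p q (S T : pred nat) : p != q ->
  (a p * a q * #|[pred u : torus a | S (u p) && T (u q)]| =
   \prod_i a i * #|[pred c : 'I_(a p) | S c]| * #|[pred c : 'I_(a q) | T c]|)%N.
Proof.
move=> pq; pose F i (c : 'I_(a i)) := ((i == p) ==> S c) && ((i == q) ==> T c).
have -> : #|[pred u : torus a | S (u p) && T (u q)]| = (\prod_i #|F i|)%N.
  rewrite -card_box; apply: eq_card => u; rewrite !inE.
  apply/andP/forallP => [[Sp Tq] i|H].
    by apply/andP; split; apply/implyP => /eqP ->.
  by have := H p; have := H q; rewrite /F !eqxx /= => /andP[_ ->] /andP[->].
have Fp : #|F p| = #|[pred c : 'I_(a p) | S c]|.
  by apply: eq_card => c; rewrite !inE /F unfold_in eqxx (negPf pq) andbT.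
have Fq : #|F q| = #|[pred c : 'I_(a q) | T c]|.
  by apply: eq_card => c; rewrite !inE /F unfold_in eqxx eq_sym (negPf pq).
rewrite (bigD1 p) //= (bigD1 q) 1?eq_sym //= [in RHS](bigD1 p) //=.
rewrite [in RHS](bigD1 q) 1?eq_sym //= Fp Fq.
rewrite (eq_bigr (fun i => a i)) => [|i /andP[ip iq]]; last first.
  by rewrite -[RHS]card_ord; apply: eq_card => c; rewrite unfold_in /F (negPf ip) (negPf iq).
by ring.
Qed.

Section Logarithm.
Variables (p q : 'I_N) (y : torus a) (r : nat).
Hypotheses (pq : p != q) (r_gt0 : (0 < r)%N).

Definition plane_dist u :=
  maxn (cyc_dist (a p) (u p) (y p)) (cyc_dist (a q) (u q) (y q)).

(** Spheres of the plane grow linearly, which turns the squares 1 / s^2 of the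
    increments into the harmonic sum again. *)
Lemma card_plane_sphere s : (0 < s)%N ->
  (a p * a q * #|[pred u | plane_dist u == s]| <= \prod_i a i * (40 * s))%N.
Proof.
move=> s0; pose dp c := cyc_dist (a p) c (y p); pose dq c := cyc_dist (a q) c (y q).
pose U := [set u : torus a | (dp (u p) == s) && (dq (u q) <= s)%N].
pose V := [set u : torus a | (dp (u p) <= s)%N && (dq (u q) == s)].
have UV : (#|[pred u | plane_dist u == s]| <= #|U| + #|V|)%N.
  have [+ _] := leq_card_setU U V; apply: leq_trans; apply: subset_leq_card.
  apply/fintype.subsetP => u; rewrite !inE /plane_dist -/(dp _) -/(dq _).
  by move: (dp _) (dq _) => m n; rewrite /maxn; case: ifP; lia.
have cU : (a p * a q * #|U| <= \prod_i a i * 4 * (4 * s + 1))%N.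
  rewrite cardsE (card_two_coords (fun c => dp c == s) (fun c => dq c <= s)%N pq).
  apply: leq_mul; last exact: card_cyc_ball.
  by rewrite leq_mul2l card_cyc_sphere ?orbT.
have cV : (a p * a q * #|V| <= \prod_i a i * (4 * s + 1) * 4)%N.
  rewrite cardsE (card_two_coords (fun c => dp c <= s)%N (fun c => dq c == s) pq).
  apply: leq_mul; last exact: card_cyc_sphere.
  by rewrite leq_mul2l card_cyc_ball ?orbT.
apply: leq_trans (leq_mul (leqnn (a p * a q)) UV) _; rewrite mulnDr.
by move: cU cV; move: (a p * a q * #|U|)%N (a p * a q * #|V|)%N (\prod_i a i)%N; nia.
Qed.

(* Bounds the squared increment of the truncated harmonic sum on an edge that meets
   the sphere of radius [s]. *)
Let weight s : R := if (0 < s <= r)%N then (s%:R ^+ 2)^-1 else 0.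

Let truncated u : R := harmonic_sum (minn r (plane_dist u)).

Let truncated_step m n : (n <= m.+1)%N -> (m <= n.+1)%N ->
  (harmonic_sum (minn r m) - harmonic_sum (minn r n)) ^+ 2 <= weight m + weight n.
Proof.
have w0 s : 0 <= weight s by rewrite /weight; case: ifP => // _; rewrite invr_ge0 sqr_ge0.
have succ s : (harmonic_sum (minn r s.+1) - harmonic_sum (minn r s)) ^+ 2 <= weight s.+1.
  have [sr|rs] := ltnP s r.
    rewrite (minn_idPr sr) /harmonic_sum big_nat_recr //=.
    by rewrite addrAC subrr add0r /weight /= sr exprVn.
  by rewrite (minn_idPl (leqW rs)) subrr expr0n w0.
move=> nm mn; have [->|[->|->]] : n = m \/ n = m.+1 \/ m = n.+1 by lia.
- by rewrite subrr expr0n addr_ge0.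
- by rewrite -sqrrN opprB (le_trans (succ m)) // lerDr.
- by rewrite (le_trans (succ n)) // lerDl.
Qed.

Let weight_sum : (a p * a q)%N%:R * (\sum_u weight (plane_dist u)) <=
  40 * (\prod_i a i)%N%:R * harmonic_sum r.
Proof.
have -> : \sum_u weight (plane_dist u) =
    \sum_(1 <= s < r.+1) #|[pred u | plane_dist u == s]|%:R * (s%:R ^+ 2)^-1.
  transitivity (\sum_(u : torus a) \sum_(1 <= s < r.+1)
      (if plane_dist u == s then (s%:R ^+ 2)^-1 else 0 : R)).
    apply: eq_bigr => u _; rewrite /weight.
    have [dr|dr] := boolP (0 < plane_dist u <= r)%N.
      rewrite (bigD1_seq (plane_dist u)) /= ?mem_index_iota ?iota_uniq // eqxx.
      by rewrite big1 ?addr0 // => s; rewrite eq_sym => /negPf ->.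
    rewrite big_nat_cond big1 // => s /andP[sr _]; case: eqP => // ds.
    by move: dr; rewrite ds -ltnS sr.
  rewrite exchange_big /=; apply: eq_bigr => s _.
  by rewrite -big_mkcond sumr_const mulr_natl.
rewrite mulr_sumr /harmonic_sum mulr_sumr big_nat_cond [X in _ <= X]big_nat_cond.
apply: ler_sum => s; rewrite andbT => /andP[s0 _].
have sR : 0 < s%:R :> R by rewrite ltr0n.
have H : (a p * a q)%N%:R * #|[pred u | plane_dist u == s]|%:R <=
    (\prod_i a i)%N%:R * (40 * s%:R) :> R.
  by rewrite -!natrM ler_nat card_plane_sphere.
apply: (@le_trans _ _ ((\prod_i a i)%N%:R * (40 * s%:R) * (s%:R ^+ 2)^-1)).
  by rewrite [X in X <= _]mulrA; apply: ler_wpM2r => //; rewrite invr_ge0 sqr_ge0.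
by rewrite le_eqVlt; apply/predU1P; left; field; rewrite gt_eqF.
Qed.

(** Test function: the potential of the plane, truncated at the distance of [x].  It
    rises from 0 at [y] to the harmonic sum at [x], and its energy is at most a
    constant times the same harmonic sum times the volume of the other coordinates. *)
Lemma green_ge_harmonic x : plane_dist x = r ->
  (a p)%:R * (a q)%:R * harmonic_sum r <= 80 * green R y x.
Proof.
move=> xr; set V : R := (\prod_i a i)%N%:R.
have apq : 0 < (a p * a q)%N%:R :> R by rewrite ltr0n muln_gt0 !(side_gt0 y).
have V0 : 0 < V by rewrite ltr0n prodn_gt0 // => i; exact: side_gt0 y i.
have H0 : 0 < harmonic_sum r.
  apply: lt_le_trans (_ : 1 <= _); first exact: ltr01.
  rewrite /harmonic_sum big_ltn //= invr1 lerDl; apply: sumr_ge0 => s _.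
  by rewrite invr_ge0.
pose B := 40 * V * harmonic_sum r / (a p * a q)%N%:R.
have B0 : 0 < B by rewrite divr_gt0 // !mulr_gt0.
have y0 : plane_dist y = 0%N.
  rewrite /plane_dist; have E i : cyc_dist (a i) (y i) (y i) = 0%N.
    by apply/eqP; rewrite cyc_dist_eq0.
  by rewrite !E.
have := @dirichlet_bound truncated B x y B0.
rewrite /truncated y0 minn0 xr minnn /harmonic_sum big_nil subr0 -/(harmonic_sum r).
rewrite card_torus -/V.
have step j : \sum_u (truncated (shift j u) - truncated u) ^+ 2 <= B *+ 2.
  apply: (@le_trans _ _ (\sum_u (weight (plane_dist (shift j u)) + weight (plane_dist u)))).
    apply: ler_sum => u _; apply: truncated_step; rewrite /plane_dist;
      have := cyc_dist_shift p j u y; have := cyc_dist_shift q j u y;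
      rewrite /maxn; do 2 case: ifP; lia.
  rewrite big_split /= (sum_shift j (fun u => weight (plane_dist u))) -mulr2n lerMn2r /=.
  by rewrite ler_pdivlMr // mulrC weight_sum.
move=> /(_ step) HB.
have VH : 0 < V * harmonic_sum r by exact: mulr_gt0.
rewrite -(ler_pM2l VH) -natrM.
have -> : V * harmonic_sum r * ((a p * a q)%N%:R * harmonic_sum r) =
   V * harmonic_sum r ^+ 2 * (a p * a q)%N%:R by ring.
apply: le_trans (ler_wpM2r (ltW apq) HB) _.
rewrite /B; move: (_ * _)%N%:R apq => W /gt_eqF W0.
by rewrite le_eqVlt; apply/predU1P; left; field; rewrite W0.
Qed.

End Logarithm.
End LowerBounds.

(** * Graph distances *)

Section GraphDistance.
Variables (V : finType) (e : rel V).
Implicit Types (x y z : V) (n : nat).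

Lemma gdist_le n x y : walk_of_length e n x y -> (gdist e x y <= n)%N.
Proof.
move=> w; rewrite /gdist; have [nV|Vn] := ltnP n #|V|; last first.
  apply: leq_trans Vn; elim/big_ind: _ => //= [m l mV lV|i _]; last exact: ltnW.
  by rewrite geq_min mV.
have : Ordinal nV \in index_enum 'I_#|V| by rewrite mem_index_enum.
elim: (index_enum _) => //= i s IHs; rewrite inE big_cons => /orP[/eqP <-|ins].
  by rewrite w geq_minl.
by case: ifP => _; [rewrite geq_min IHs ?orbT|exact: IHs].
Qed.

Lemma gdist_ge c x y : (c <= #|V|)%N ->
  (forall n, walk_of_length e n x y -> (c <= n)%N) -> (c <= gdist e x y)%N.
Proof.
move=> cV cw; rewrite /gdist; elim/big_ind: _ => // [m l cm cl|i /cw //].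
by rewrite leq_min cm cl.
Qed.

Lemma gdist_le_diam x y : (gdist e x y <= gdiam e)%N.
Proof.
apply: leq_trans (leq_bigmax x).
exact: (leq_bigmax (F := fun y => gdist e x y)).
Qed.

Lemma walk_cons n x z y : e x z -> walk_of_length e n z y -> walk_of_length e n.+1 x y.
Proof.
move=> xz /existsP[p /andP[pp pl]]; apply/existsP; exists (cons_tuple z p).
by rewrite /= xz pp.
Qed.

Lemma walk_nil x : walk_of_length e 0 x x.
Proof. by apply/existsP; exists [tuple]; rewrite /= eqxx. Qed.

Lemma walk_lipschitz (f : V -> nat) n x y :
  (forall u v, e u v -> (f u <= (f v).+1)%N) -> walk_of_length e n x y ->
  (f x <= f y + n)%N.
Proof.
move=> lip /existsP[[p /= /eqP <-] /andP[pp /eqP <-]] {y n}.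
elim: p x pp => [|z p IHp] x /=; first by rewrite addn0.
by move=> /andP[/lip xz /IHp zp]; apply: leq_trans xz _; rewrite addnS ltnS.
Qed.

End GraphDistance.

Lemma walk_has_neighbour (R : realType) (V : finType) (e : rel V) (d : measure_display)
    (Omega : measurableType d) (P : probability Omega R) (x : V) (X : nat -> Omega -> V) :
  simple_random_walk e P x X -> exists z, e x z.
Proof.
move=> [mX P0 /(_ 0%N (fun=> x)) /= step].
apply/existsP; apply: contraT; rewrite negb_exists => /forallP none.
have past : [set om | forall i, (i <= 0)%N -> X i om = x]%classic =
    [set om | X 0%N om = x]%classic.
  apply/seteqP; split=> om /= H; first exact: H.
  by move=> i; rewrite leqn0 => /eqP ->.
move: step; rewrite past => step.
have := fibre_sum P (mX 1%N) (mX 0%N x); rewrite P0 big1 /=.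
  by move/eqP; rewrite oner_eq0.
by move=> z _; rewrite step /step_prob (negPf (none z)) mul0e.
Qed.

Section TorusDistance.
Variables (N : nat) (a : 'I_N -> nat).
Implicit Types (i j : 'I_N) (u v x y : torus a).
Local Notation adj := (@torus_adj N a).

Lemma adj_shift i u : shift i u != u -> adj u (shift i u).
Proof. by move=> su; rewrite torus_adjE; apply/existsP; exists i; rewrite /adj_along su eqxx. Qed.

Lemma adj_unshift i u : unshift i u != u -> adj u (unshift i u).
Proof.
by move=> su; rewrite torus_adjE; apply/existsP; exists i; rewrite /adj_along su eqxx orbT.
Qed.

Lemma cyc_dist_adj i y {u v} : adj u v ->
  (cyc_dist (a i) (u i) (y i) <= (cyc_dist (a i) (v i) (y i)).+1)%N.
Proof.
rewrite torus_adjE => /existsP[j /andP[_ /orP[/eqP ->|/eqP ->]]].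
  by have [] := cyc_dist_shift i j u y.
by have [+ _] := cyc_dist_shift i j (unshift j u) y; rewrite unshiftK.
Qed.

(** The walk moves in a coordinate where [u] and [v] differ, in the direction that
    decreases the distance there, by induction on the sum. *)
Lemma torus_gdist_le u v :
  (gdist adj u v <= \sum_i cyc_dist (a i) (u i) (v i))%N.
Proof.
apply: gdist_le; move En: (\sum_i _)%N => n; elim: n u En => [|n IHn] u En.
  suff -> : u = v by exact: walk_nil.
  apply/ffunP => i; apply: val_inj; apply/eqP.
  rewrite -(cyc_dist_eq0 (n := a i)) ?ltn_ord //.
  by have /eqP := En; rewrite sum_nat_eq0 => /forallP/(_ i).
have [i uvi] : exists i, (u i : nat) != v i.
  apply/existsP; apply: contraT; rewrite negb_exists => /forallP uv.
  by move: En; rewrite big1 // => i _; apply/eqP; rewrite cyc_dist_eq0 // -[_ == _]negbK uv.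
have sum_upd (w : torus a) : (forall j, j != i -> w j = u j) ->
    cyc_dist (a i) (u i) (v i) = (cyc_dist (a i) (w i) (v i)).+1 ->
    (\sum_j cyc_dist (a j) (w j) (v j) = n)%N.
  move=> wj wi; move: En; rewrite (bigD1 i) //= wi addSn => -[<-].
  by rewrite [LHS](bigD1 i) //=; congr (_ + _)%N; apply: eq_bigr => j /wj ->.
have neq (w : torus a) : cyc_dist (a i) (u i) (v i) = (cyc_dist (a i) (w i) (v i)).+1 ->
    w != u.
  by move=> wi; apply/eqP => wu; move: wi; rewrite wu; exact: n_Sn.
have [st|st] := cyc_dist_towards (ltn_ord (v i)) uvi.
- have s_i : cyc_dist (a i) (u i) (v i) = (cyc_dist (a i) (shift i u i) (v i)).+1.
    by rewrite shift_at eqxx.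
  apply: walk_cons (adj_shift (neq _ s_i)) (IHn _ (sum_upd _ _ s_i)) => j ji.
  by rewrite shift_at (negPf ji).
- have s_i : cyc_dist (a i) (u i) (v i) = (cyc_dist (a i) (unshift i u i) (v i)).+1.
    by rewrite unshift_at eqxx.
  apply: walk_cons (adj_unshift (neq _ s_i)) (IHn _ (sum_upd _ _ s_i)) => j ji.
  by rewrite unshift_at (negPf ji).
Qed.

(** The distance along coordinate [i] changes by at most 1 per step, and the point
    opposite to [u] on that cycle is at distance a_i / 2. *)
Lemma half_side_le_diam i u : (a i %/ 2 <= gdiam adj)%N.
Proof.
pose w : torus a := finfun (fun j => if j == i
  then Ordinal (ltn_pmod (u j + a j %/ 2) (side_gt0 u j)) else u j).
have ui := ltn_ord (u i).
have wu : (a i %/ 2 <= cyc_dist (a i) (w i) (u i))%N.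
  rewrite ffunE eqxx /=; have [lt|ge] := ltnP (u i + a i %/ 2) (a i).
    by rewrite modn_small // /cyc_dist /minn; case: ifP; lia.
  rewrite -(subnK ge) modnDr modn_small; last by lia.
  rewrite /cyc_dist; move: (nat_of_ord (u i)) ui ge; move: (a i) => n m mn ge.
  have -> : (m + n %/ 2 - n - m + (m - (m + n %/ 2 - n)) = n - n %/ 2)%N by lia.
  by rewrite leq_min; lia.
apply: leq_trans (gdist_le_diam adj w u); apply: gdist_ge.
  have : (a i <= #|torus a|)%N.
    rewrite card_torus (bigD1 i) //= leq_pmulr // prodn_gt0 // => j; exact: side_gt0 u j.
  by apply: leq_trans; exact: leq_div.
move=> n /(walk_lipschitz (f := fun v : torus a => cyc_dist (a i) (v i) (u i)) (@cyc_dist_adj i u)); have := wu.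
suff -> : cyc_dist (a i) (u i) (u i) = 0%N by rewrite add0n; exact: leq_trans.
by apply/eqP; rewrite cyc_dist_eq0.
Qed.

Lemma adj_side_ge2 u v : adj u v -> exists i, (1 < a i)%N.
Proof.
rewrite torus_adjE => /existsP[i /andP[vu H]]; exists i; have ui := ltn_ord (u i).
rewrite ltnNge; apply: contra vu => ai; apply/eqP/ffunP => j.
have [ji|/negPf ji] := eqVneq j i; last by case/orP: H => /eqP ->; rewrite ffunE ji.
rewrite ji; apply: val_inj; have := ltn_ord (v i); move: ui ai => /=; lia.
Qed.

Lemma torus_deg_gt0 i : (1 < a i)%N -> (0 < torus_deg a)%N.
Proof.
by move=> ai; rewrite /torus_deg (bigD1 i) //= addn_gt0 /cycle_deg; apply/orP; left; lia.
Qed.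

End TorusDistance.

(** * Two-sided comparison *)

Section TopSides.
Variables (N : nat) (a : 'I_N -> nat).
Hypothesis sides : torus_sides a.

Lemma top_side_ord (i : 'I_N) : top_side a (N - i.+1) = a i.
Proof.
have iN := ltn_ord i; rewrite /top_side nth_rev size_codom card_ord; last by lia.
rewrite (_ : N - (N - i.+1).+1 = i)%N; last by lia.
by rewrite (nth_map i) ?size_enum_ord // nth_ord_enum.
Qed.

Lemma top_side_attained k : (k < N)%N ->
  exists2 i : 'I_N, a i = top_side a k & (i + k.+1 = N)%N.
Proof.
move=> kN; have iN : (N - k.+1 < N)%N by lia.
exists (Ordinal iN); last by rewrite /=; lia.
by rewrite -top_side_ord /=; congr (top_side a _); lia.
Qed.

Lemma side_le_third (i : 'I_N) : (i.+2 < N)%N -> (a i <= top_side a 2)%N.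
Proof.
move=> iN; have [|j <- ij] := @top_side_attained 2; first by lia.
by case: sides => _; apply; lia.
Qed.

Lemma last_two_ord (p q : 'I_N) : (p + 2 = N)%N -> (q + 1 = N)%N ->
  p != q /\ forall i : 'I_N, (N <= i.+2)%N -> i = p \/ i = q.
Proof.
move=> pN qN; split=> [|i iN].
  by apply/eqP => /(congr1 val) /= pq; lia.
have [ip|ip] := eqVneq (i : nat) p; [left|right]; apply: val_inj => //=.
by have := ltn_ord i; move/eqP: ip; lia.
Qed.

End TopSides.

Section Comparison.
Variables (R : realType) (N : nat) (a : 'I_N -> nat) (x y : torus a) (c : R).
Hypotheses (sides : torus_sides a) (N_gt0 : (0 < N)%N) (c_gt0 : 0 < c).
Hypotheses (side2 : (1 < top_side a 0)%N)
  (far : c * (gdiam (@torus_adj N a))%:R <= (gdist (@torus_adj N a) x y)%:R).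

(** The factor 3 absorbs the rounding in a / 3 <= a %/ 2 for a >= 2; the factor N
    comes from choosing the largest of N coordinate distances. *)
Definition far_ratio : R := c / (3 * N%:R).

Lemma far_ratio_gt0 : 0 < far_ratio.
Proof. by rewrite divr_gt0 ?mulr_gt0 ?ltr0n. Qed.

Lemma far_coordinate :
  exists i, far_ratio * (top_side a 0)%:R <= (cyc_dist (a i) (x i) (y i))%:R.
Proof.
have NR : 0 < N%:R :> R by rewrite ltr0n.
have [i0 ai0 _] := top_side_attained a N_gt0.
pose i := [arg max_(i > i0) cyc_dist (a i) (x i) (y i)].
exists i; set m := cyc_dist _ _ _.
have dm : (gdist (@torus_adj N a) x y <= N * m)%N.
  apply: leq_trans (torus_gdist_le x y) _.
  rewrite -[X in (_ <= X * m)%N](card_ord N) -sum_nat_const; apply: leq_sum => j _.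
  by rewrite /m /i; case: arg_maxnP => // k _; apply.
have Dge : (top_side a 0 <= 3 * gdiam (@torus_adj N a))%N.
  by have := half_side_le_diam i0 x; rewrite ai0; move: side2; lia.
move: dm Dge; rewrite -(ler_nat R) -[(_ <= 3 * _)%N](ler_nat R) !natrM => dm Dge.
rewrite /far_ratio mulrAC ler_pdivrMr ?mulr_gt0 //.
have := ler_wpM2l (ltW c_gt0) Dge; have := le_trans far dm.
by move: (_ _)%:R (gdiam _)%:R m%:R => A' D' m'; lra.
Qed.

(** The three terms of the scale are bounded separately.  The logarithmic one needs
    the distance between [x] and [y] to be realised in one of the two longest
    coordinates; otherwise [near_third] bounds it by the square. *)
Lemma green_lower : hitting_scale R a <=
  (82 + 2 * far_ratio^-1 ^+ 2 + 2 * far_ratio^-1 ^+ 3) * green R y x.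
Proof.
have [C0 CB BA _ aA] := top_sides_order sides.
have s0 := far_ratio_gt0; have [i far_i] := far_coordinate.
set G := green R y x; set s := far_ratio^-1.
have sp : 0 < s by rewrite invr_gt0.
have [i0 ai0 _] := top_side_attained a N_gt0.
have deg0 : (0 < torus_deg a)%N by apply: (torus_deg_gt0 (i := i0)); rewrite ai0.
set A : R := (top_side a 0)%:R; set B : R := (top_side a 1)%:R.
set C : R := (top_side a 2)%:R; set d := cyc_dist _ _ _ in far_i.
have A0 : 0 < A by rewrite ltr0n ltnW.
have CR : 0 < C by rewrite ltr0n.
have BR : 0 < B by rewrite ltr0n (leq_trans C0).
have BAR : B <= A by rewrite ler_nat.
have As : A <= s * d%:R.
  by rewrite /s mulrC ler_pdivlMr // mulrC.
have G0 : 0 <= G by apply: green_ge0.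
have sq : A ^+ 2 <= 2 * s ^+ 2 * G.
  apply: (@le_trans _ _ ((s * d%:R) ^+ 2)).
    by rewrite lerXn2r ?nnegrE ?mulr_ge0 // ltW.
  rewrite exprMn (_ : 2 * s ^+ 2 * G = s ^+ 2 * (2 * G)); last by ring.
  by rewrite ler_wpM2l ?sqr_ge0 //; exact: green_ge_square.
have vol : (\prod_i a i)%N%:R <= 2 * G.
  rewrite -card_torus; apply: green_ge_volume => //; apply/eqP => xy.
  have d0 : d = 0%N by apply/eqP; rewrite /d xy cyc_dist_eq0.
  by move: As; rewrite d0 mulr0 leNgt A0.
have ABA : A * B <= A ^+ 2 by rewrite expr2 ler_wpM2l // ltW.
have near_third : (a i <= top_side a 2)%N -> A * B * ln (B / C) <= A ^+ 2 * s.
  move=> aiC; have dC : d%:R <= C.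
    by rewrite ler_nat; apply: leq_trans aiC; exact: cyc_dist_le_side.
  have BC : B / C <= s.
    rewrite ler_pdivrMr //; apply: le_trans BAR (le_trans As _).
    by rewrite ler_wpM2l // ltW.
  apply: ler_pM => //; first by rewrite mulr_ge0 ?ltW.
    by rewrite ln_ge0 // ler_pdivlMr // mul1r ler_nat.
  by apply: le_trans BC; rewrite ltW // ln_sublinear // divr_gt0.
have log : A * B * ln (B / C) <= 80 * G + A ^+ 2 * s.
  have nonneg : A * B * ln (B / C) <= A ^+ 2 * s -> A * B * ln (B / C) <= 80 * G + A ^+ 2 * s.
    by move/le_trans; apply; rewrite lerDr mulr_ge0.
  have [iN|Ni] := ltnP i.+2 N; first exact/nonneg/near_third/side_le_third.
  have [N1|N1] := leqP N 1.
    have B1 : B = 1.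
      by rewrite /B /top_side nth_default // size_rev size_codom card_ord.
    have C1 : C = 1.
      by rewrite /C /top_side nth_default // size_rev size_codom card_ord ltnW.
    by apply: nonneg; rewrite B1 C1 divr1 ln1 mulr0 mulr_ge0 ?sqr_ge0 // ltW.
  have [q aq qN] := top_side_attained a N_gt0.
  have [p ap pN] := top_side_attained a N1.
  have [pq ipq] := last_two_ord pN qN.
  set r := plane_dist p q y x.
  have dr : (d <= r)%N.
    by rewrite /d /r /plane_dist; have [->|->] := ipq i Ni; [exact: leq_maxl|exact: leq_maxr].
  have d0 : (0 < d)%N.
    rewrite lt0n; apply/eqP => d0; move: As; rewrite d0 mulr0 leNgt A0 //.
  have r0 : (0 < r)%N by exact: leq_trans dr.
  have := green_ge_harmonic R deg0 pq r0 (erefl r).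
  rewrite ap aq -/G [_%:R * _%:R]mulrC -/A -/B => Hr.
  have lnB : ln (B / C) <= harmonic_sum R r + s.
    have BA' : B / C <= s * r.+1%:R.
      rewrite ler_pdivrMr //; apply: le_trans BAR (le_trans As _).
      apply: le_trans (_ : s * r.+1%:R * 1 <= _).
        by rewrite mulr1 ler_wpM2l ?(ltW sp) // ler_nat ltnW.
      by rewrite ler_wpM2l ?ler1n // mulr_ge0 // ltW.
    have pos : 0 < B / C by exact: divr_gt0.
    have pos' : 0 < s * r.+1%:R by exact: mulr_gt0.
    apply: (@le_trans _ _ (ln (s * r.+1%:R))); first by rewrite ler_ln.
    rewrite lnM ?posrE // addrC; apply: lerD; first exact: ln_le_harmonic_sum.
    by rewrite ltW // ln_sublinear.
  apply: le_trans (ler_wpM2l _ lnB) _; first by rewrite mulr_ge0 ?ltW.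
  by rewrite mulrDr; apply: lerD => //; rewrite ler_wpM2r // ltW.
have s2 : 0 <= s ^+ 2 * G by rewrite mulr_ge0 ?sqr_ge0.
have s3 : A ^+ 2 * s <= 2 * s ^+ 3 * G.
  rewrite (_ : 2 * s ^+ 3 * G = 2 * s ^+ 2 * G * s); last by ring.
  by rewrite ler_wpM2r // ltW.
have s3' : 0 <= s ^+ 3 * G by rewrite mulr_ge0 ?exprn_ge0 // ltW.
have E : (82 + 2 * s ^+ 2 + 2 * s ^+ 3) * G = 82 * G + 2 * s ^+ 2 * G + 2 * s ^+ 3 * G.
  by ring.
rewrite /hitting_scale -/A -/B -/C E !ge_max; apply/and3P; split; lra.
Qed.

End Comparison.

Lemma hitting_time_green (R : realType) (N : nat) (a : 'I_N -> nat) (x y : torus a)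
    (d : measure_display) (Omega : measurableType d) (P : probability Omega R)
    (X : nat -> Omega -> torus a) :
  simple_random_walk (@torus_adj N a) P x X -> x != y ->
  expected_hitting_time P X y = (green R y x)%:E.
Proof.
move=> walkX xy; have [z /adj_side_ge2[i ai]] := walk_has_neighbour walkX.
apply: (expected_hitting_time_poisson walkX xy).
- exact: green_id.
- exact: green_ge0.
- by move=> v; apply: green_poisson (torus_deg_gt0 ai).
Qed.

Lemma hitting_comparable_torus (R : realType) (N : nat) : (1 <= N)%N ->
  hitting_comparable (@torus_sides N) (fun a : 'I_N -> nat => hitting_scale R a).
Proof.
move=> N_gt0 c c_gt0.
have s0 := far_ratio_gt0 N_gt0 c_gt0.
pose K1 : R := 82 + 2 * (far_ratio N c)^-1 ^+ 2 + 2 * (far_ratio N c)^-1 ^+ 3.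
pose K2 : R := (16 * N * 5 ^ N)%N%:R * 4.
have K1_gt0 : 0 < K1.
  have : 0 <= (far_ratio N c)^-1 ^+ 2 by rewrite sqr_ge0.
  have : 0 <= (far_ratio N c)^-1 ^+ 3 by rewrite exprn_ge0 // invr_ge0 ltW.
  by rewrite /K1; lra.
have K2_ge0 : 0 <= K2 by rewrite mulr_ge0.
exists (K1 + K2) => [|a sides x y far d Omega P X walkX]; first by lra.
have [z /adj_side_ge2[i ai]] := walk_has_neighbour walkX.
have [_ _ _ _ /(_ i) aA] := top_sides_order sides.
have side2 := leq_trans ai aA.
have lower := green_lower sides N_gt0 c_gt0 side2 far.
have F0 : 0 < hitting_scale R a.
  rewrite /hitting_scale !lt_max; apply/orP; left.
  by rewrite ltr0n prodn_gt0 // => j; case: sides.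
have xy : x != y.
  apply: contraTneq lower => ->; rewrite green_id mulr0 -ltNge //.
rewrite (hitting_time_green walkX xy) !lee_fin; have K0 : 0 < K1 + K2 by lra.
have G0 := green_ge0 R y x; split.
- rewrite mulrC ler_pdivrMr // mulrC; apply: le_trans lower _.
  by apply: ler_wpM2r => //; rewrite lerDl.
- apply: le_trans (green_upper R sides x y) _.
  by apply: ler_wpM2r; [exact: ltW|rewrite lerDr ltW].
Qed.

Lemma hitting_scale_flat (R : realType) (a : 'I_3 -> nat) :
  torus_sides a -> a (inord 0) = 1%N ->
  hitting_scale R a =
    Num.max ((a (inord 2))%:R * (a (inord 1))%:R * ln (a (inord 1))%:R)
            ((a (inord 2))%:R ^+ 2).
Proof.
move=> sides a0.
have t k : (k < 3)%N -> top_side a k = a (inord (2 - k)).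
  move=> k3; rewrite -(top_side_ord a (inord (2 - k))) inordK; last by lia.
  by congr (top_side a _); lia.
have V : (\prod_i a i = a (inord 2) * a (inord 1))%N.
  rewrite 3!big_ord_recl big_ord0 muln1.
  have -> : ord0 = inord 0 :> 'I_3 by apply: val_inj; rewrite /= inordK.
  have -> : lift (inord 0) ord0 = inord 1 :> 'I_3 by apply: val_inj; rewrite /= !inordK.
  have -> : lift (inord 0) (lift ord0 ord0) = inord 2 :> 'I_3.
    by apply: val_inj; rewrite /= !inordK.
  by rewrite a0 mul1n mulnC.
rewrite /hitting_scale V !t //= a0 divr1; apply/max_idPr.
rewrite le_max; apply/orP; right; rewrite natrM expr2 ler_wpM2l // ler_nat.
by case: sides => _; apply; rewrite !inordK.
Qed.

Theorem proposition6p2 (R : realType) :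
  (forall N : nat, (1 <= N)%N ->
     hitting_comparable (@torus_sides N) (fun a : 'I_N -> nat => hitting_scale R a)) /\
  (forall a : 'I_3 -> nat, torus_sides a -> a (inord 0) = 1%N ->
     hitting_scale R a =
       Num.max ((a (inord 2))%:R * (a (inord 1))%:R * ln (a (inord 1))%:R)
               ((a (inord 2))%:R ^+ 2)) /\
  hitting_comparable
    (fun a : 'I_3 -> nat => torus_sides a /\ a (inord 0) = 1%N)
    (fun a : 'I_3 -> nat =>
       Num.max ((a (inord 2))%:R * (a (inord 1))%:R * ln (a (inord 1))%:R)
               ((a (inord 2))%:R ^+ 2) : R).
Proof.
have comparable N := @hitting_comparable_torus R N.
split=> //; split; first exact: hitting_scale_flat.
move=> c c_gt0; have [C C_gt0 HC] := comparable 3%N isT c c_gt0.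
exists C => // a [sides a0] x y far d Omega P X walkX.
rewrite -(hitting_scale_flat R sides a0).
exact: HC a sides x y far d Omega P X walkX.
Qed.
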